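(* Fix a base LCSTRS $\mathcal{R}_0$, a set $H$ of hidden symbols of $\mathcal{R}_0$, and a public extension $\mathcal{R}_1$ of $\mathcal{R}_0$ (with a sort ordering on the sorts of $\mathcal{R}_0\cup\mathcal{R}_1$ with respect to which computability is taken), and let $\mathcal{R}=\mathcal{R}_0\cup\mathcal{R}_1$. Then the following processors on universal DP problems are sound: (a) for each graph processor, subterm criterion processor or integer mapping processor $\rho$ (defined with respect to $\mathcal{R}$), the processor $\rho'$ with $\rho'(\mathcal{P},\mathtt{p})=\{(\mathcal{P}',\mathfrak{an}):\mathcal{P}'\in\rho(\mathcal{P})\}$; (b) universal theory argument processors; (c) constraint modification processors; (d) reachability processors.
   Context: LCSTRSs. Fix sorts $\mathcal{S}$ with theory sorts $\mathcal{S}_{\mathrm{th}}$; types $\mathcal{T}::=\mathcal{S}\mid(\mathcal{T}\to\mathcal{T})$. Terms are well-typed applicative expressions over typed function symbols $\mathcal{F}$ and variables (infinitely many per type); $\mathrm{FV}(t)$ is the set of variables; ground means variable-free. Theory symbols $\mathcal{F}_{\mathrm{th}}\subseteq\mathcal{F}$ have types of the form $S_1\to\cdots\to S_k$ with all $S_i\in\mathcal{S}_{\mathrm{th}}$; those of sort type are values; theory terms are built from theory symbols and variables; $T(\mathcal{F}_{\mathrm{th}},L)$ denotes theory terms with variables in $L$. Theory symbols are interpreted by $[\![\cdot]\!]$ in sets $\mathfrak{X}_A$ (bijectively on values), extended to ground theory terms; $\mathsf{bool}\in\mathcal{S}_{\mathrm{th}}$, $\mathfrak{t},\mathfrak{f}\mapsto1,0$.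 A logical constraint is a $\mathsf{bool}$-typed theory term with theory-sorted variables. A rule $\ell\to r\ [\varphi]$ ($\ell=f\,t_1\cdots t_n$ a pattern with a non-theory symbol, $r$ of the same type, $\varphi$ a logical constraint, theory-sorted variables in $\mathrm{FV}(r)\setminus\mathrm{FV}(\ell)$) rewrites $C[\ell\sigma]\to C[r\sigma]$ when $\sigma$ maps $\mathrm{FV}(\varphi)\cup(\mathrm{FV}(r)\setminus\mathrm{FV}(\ell))$ to values and $[\![\varphi\sigma]\!]=1$; additionally calculation steps $C[f\,v_1\cdots v_n]\to C[v']$ ($f$ theory symbol, $n>0$, values, $[\![f\,v_1\cdots v_n]\!]=[\![v']\!]$). Defined symbols head left-hand sides. $s\trianglerighteq t$ iff $s=t$, or $s=s_0\,s_1$ with $s_1\trianglerighteq t$, or with $s_0\trianglerighteq t$ and $s_0\ne t$; $\triangleright$ strict part. Computability is $\mathbb{C}$-computability: with a sort ordering $\succsim$ (quasi-order, well-founded strict part $\succ$), $A\succsim_+B_1\to\cdots\to B_n\to C$ iff $A\succsim C$ and all $A\succ_-B_i$, $A\succ_-B$ iff $A\succ C$ and all $A\succsim_+B_i$; $\mathrm{Acc}(f)=\{i:B\succsim_+A_i\}$ for $f:A_1\to\cdots\to A_n\to B$; an RC-set is a sort-indexed family of sets of terminating terms, closed under rewriting, containing neutral terms $x\,t_1\cdots t_n$ all of whose reducts belong to it; $I$-computable means in $I$ for sort type, and mapping $I$-computable arguments to $I$-computable terms for arrow type; $s\Rrightarrow_It$ iff both of base type, $s=f\,s_1\cdots s_m$,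 $t=s_k\,t_1\cdots t_n$ with $k\in\mathrm{Acc}(f)$, $t_i$ $I$-computable; $\mathbb{C}$ is the (known to exist) RC-set with $t\in\mathbb{C}_A$ iff $t$ terminates under $\to\cup\Rrightarrow_{\mathbb{C}}$ and every reduct $f\,t_1\cdots t_n$ has $t_i$ $\mathbb{C}$-computable for $i\in\mathrm{Acc}(f)$. SDPs: for defined $f:A_1\to\cdots\to A_n\to B$ a fresh $f^\sharp:A_1\to\cdots\to A_n\to\mathsf{dp}$ ($\mathsf{dp}$ a fresh sort). An SDP is $s^\sharp\Rightarrow t^\sharp\ [\varphi\mid L]$ ($\mathsf{dp}$-typed sides headed by marked symbols, $\varphi$ logical constraint, $L\supseteq\mathrm{FV}(\varphi)$ theory-sorted variables); $\sigma$ respects it if $\sigma(x)$ is a ground theory term for $x\in L$ and $[\![\varphi\sigma]\!]=1$. A $(\mathcal{P},\mathcal{R})$-chain is a finite or infinite sequence $(p_i,\sigma_i)$, $p_i=s_i^\sharp\Rightarrow t_i^\sharp\ [\varphi_i\mid L_i]\in\mathcal{P}$, $\sigma_i$ respects $p_i$, $t_{i-1}^\sharp\sigma_{i-1}\to_{\mathcal{R}}^*s_i^\sharp\sigma_i$; computable if $u\sigma_i$ is computable whenever $t_i\triangleright u$ ($t_i$ = $t_i^\sharp$ unmarked). Extensions: $\mathcal{R}_1$ is an extension of $\mathcal{R}_0$ if interpretations agree on common theory symbols and no symbol of $\mathcal{R}_0$ is defined in $\mathcal{R}_1$; it is public if no symbol of $H$ occurs in its rules. An SDP $f^\sharp\,s_1\cdots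 s_m\Rightarrow t^\sharp\ [\varphi\mid L]$ is public if $f\notin H$; a chain is public if its first SDP is public. Universal DP problems: a pair $(\mathcal{P},\mathtt{p})$ with $\mathcal{P}$ a set of SDPs and $\mathtt{p}\in\{\mathfrak{an},\mathfrak{pu}\}$; finite if $\mathtt{p}=\mathfrak{an}$ and there is no infinite computable $(\mathcal{P},\mathcal{R})$-chain, or $\mathtt{p}=\mathfrak{pu}$ and there is no infinite computable public $(\mathcal{P},\mathcal{R})$-chain. A processor partially maps universal DP problems to sets of universal DP problems; it is sound if $(\mathcal{P},\mathtt{p})$ is finite whenever all problems in its output are finite. Base processors (on sets $\mathcal{P}$ of SDPs, w.r.t. $\mathcal{R}$): A graph approximation $(G_\theta,\theta)$ for $\mathcal{P}$ is a finite directed graph with a map $\theta:\mathcal{P}\to$ vertices having an edge $\theta(p_0)\to\theta(p_1)$ whenever $(p_0,\sigma_0),(p_1,\sigma_1)$ is a $(\mathcal{P},\mathcal{R})$-chain for some $\sigma_0,\sigma_1$; a graph processor returns $\{\{p:\theta(p)\in S\}:S$ a non-trivial SCC of $G_\theta\}$ for some graph approximation. $\mathrm{Head}(\mathcal{P})$: symbols heading either side of an SDP in $\mathcal{P}$. A projection $\nu$ maps $f^\sharp\in\mathrm{Head}(\mathcal{P})$ of arity $n$ into $\{1,\dots,n\}$, $\bar\nu(f^\sharp\,t_1\cdots t_n)=t_{\nu(f^\sharp)}$; a subterm criterion processor returns $\{\mathcal{P}\setminus\mathcal{P}'\}$ for non-empty $\mathcal{P}'$ such that some $\nu$ has $\bar\nu(s^\sharp)\triangleright\bar\nu(t^\sharp)$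 on $\mathcal{P}'$ and $\bar\nu(s^\sharp)=\bar\nu(t^\sharp)$ on $\mathcal{P}\setminus\mathcal{P}'$. Integer mapping processors (assuming $\mathsf{int}\in\mathcal{S}_{\mathrm{th}}$ and standard $\ge,>,\wedge$): $\mathrm{FI}(f^\sharp)$ is the set of argument positions $i$ of theory sort such that the $i$-th argument of every occurrence of $f^\sharp$ in an SDP $s^\sharp\Rightarrow t^\sharp\ [\varphi\mid L]\in\mathcal{P}$ is in $T(\mathcal{F}_{\mathrm{th}},L)$; an integer mapping $\mathcal{J}$ assigns each $f^\sharp$ an $\mathsf{int}$-typed theory term over fresh variables $x_{f^\sharp,i}$ ($i\in\mathrm{FI}(f^\sharp)$), $\bar{\mathcal{J}}(f^\sharp\,t_1\cdots t_n)=\mathcal{J}(f^\sharp)[x_{f^\sharp,i}:=t_i]$; with $\varphi\models\varphi'$ meaning every value-substitution making $\varphi$ true makes $\varphi'$ true, the processor returns $\{\mathcal{P}\setminus\mathcal{P}'\}$ for non-empty $\mathcal{P}'$ such that some $\mathcal{J}$ has $\varphi\models\bar{\mathcal{J}}(s^\sharp)\ge0\wedge\bar{\mathcal{J}}(s^\sharp)>\bar{\mathcal{J}}(t^\sharp)$ on $\mathcal{P}'$ and $\varphi\models\bar{\mathcal{J}}(s^\sharp)\ge\bar{\mathcal{J}}(t^\sharp)$ on $\mathcal{P}\setminus\mathcal{P}'$. Theory argument mappings: $\tau$ maps each $f^\sharp\in\mathrm{Head}(\mathcal{P})$, $f^\sharp:A_1\to\cdots\to A_m\to\mathsf{dp}$,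 to a subset of $\{i:A_i\in\mathcal{S}_{\mathrm{th}}\}$ such that for every $f^\sharp\,s_1\cdots s_m\Rightarrow t^\sharp\ [\varphi\mid L]\in\mathcal{P}$ and $i\in\tau(f^\sharp)$, $s_i$ is a theory term with theory-sorted variables, and for every $f^\sharp\,s_1\cdots s_m\Rightarrow g^\sharp\,t_1\cdots t_n\ [\varphi\mid L]\in\mathcal{P}$ and $j\in\tau(g^\sharp)$, $t_j$ is a theory term with $\mathrm{FV}(t_j)\subseteq L\cup\bigcup_{i\in\tau(f^\sharp)}\mathrm{FV}(s_i)$. $\bar\tau$ replaces $L$ of $f^\sharp\,s_1\cdots s_m\Rightarrow t^\sharp\ [\varphi\mid L]$ by $L\cup\bigcup_{i\in\tau(f^\sharp)}\mathrm{FV}(s_i)$. $\tau$ fixes $\mathcal{P}'\subseteq\mathcal{P}$ if $\bigcup_{i\in\tau(f^\sharp)}\mathrm{FV}(t_i)\subseteq L$ for each $s^\sharp\Rightarrow f^\sharp\,t_1\cdots t_n\ [\varphi\mid L]\in\mathcal{P}'$. A universal theory argument processor, given non-empty $\mathcal{P}'\subseteq\mathcal{P}$ fixed by some $\tau$, maps $(\mathcal{P},\mathfrak{an})$ to $\{(\{\bar\tau(p):p\in\mathcal{P}\},\mathfrak{an}),(\mathcal{P}\setminus\mathcal{P}',\mathfrak{an})\}$; maps $(\mathcal{P},\mathfrak{pu})$ to $\{(\{p\in\mathcal{P}:p\text{ public}\}\cup\{\bar\tau(p):p\in\mathcal{P}\text{ not public}\},\mathfrak{pu})\}$ if $\mathcal{P}'$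 contains all public SDPs of $\mathcal{P}$, and otherwise to $\{(\{\bar\tau(p):p\in\mathcal{P}\},\mathfrak{an}),(\mathcal{P}\setminus\mathcal{P}',\mathfrak{pu})\}$. A set $\mathcal{P}_2$ of SDPs covers $\mathcal{P}_1$ if for each $s^\sharp\Rightarrow t^\sharp\ [\varphi_1\mid L_1]\in\mathcal{P}_1$ and $\sigma_1$ respecting it, there are $s^\sharp\Rightarrow t^\sharp\ [\varphi_2\mid L_2]\in\mathcal{P}_2$ (same $s^\sharp,t^\sharp$) and $\sigma_2$ respecting it with $s\sigma_1=s\sigma_2$ and $t\sigma_1=t\sigma_2$. A constraint modification processor maps $(\mathcal{P},\mathtt{p})$ to $\{(\mathcal{P}',\mathtt{p})\}$ for some $\mathcal{P}'$ covering $\mathcal{P}$. A reachability processor, given a graph approximation $(G_\theta,\theta)$ for $\mathcal{P}$, maps $(\mathcal{P},\mathfrak{pu})$ to $\{(\{p\in\mathcal{P}:\theta(p)\text{ is reachable from }\theta(p_0)\text{ for some public }p_0\in\mathcal{P}\},\mathfrak{pu})\}$. *)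

(* Defs.v *)
From Stdlib Require Import Relation_Operators.
From mathcomp Require Import all_boot all_order ssralg ssrnum ssrint.
From mathcomp Require Import boolp classical_sets.

Set Implicit Arguments.
Unset Strict Implicit.
Unset Printing Implicit Defensive.

Local Open Scope classical_set_scope.

Inductive type (S : Type) : Type := Base of S | Arr of type S & type S.

Fixpoint arg_types S (A : type S) : seq (type S) :=
  if A is Arr B C then B :: arg_types C else [::].

Fixpoint target S (A : type S) : S :=
  match A with Base s => s | Arr _ C => target C end.

Fixpoint retarget S (d : S) (A : type S) : type S :=
  match A with Base _ => Base d | Arr B C => Arr B (retarget d C) end.

Fixpoint over_sorts S (X : set S) (A : type S) : Prop :=
  match A with Base s => X s | Arr B C => over_sorts X B /\ over_sorts X C end.

(* [S1 -> ... -> Sk] with every [Si] in [X]. *)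
Fixpoint first_order S (X : set S) (A : type S) : Prop :=
  match A with
  | Base s => X s
  | Arr (Base s) C => X s /\ first_order X C
  | Arr (Arr _ _) _ => False
  end.

Fixpoint dom S (X : S -> Type) (A : type S) : Type :=
  match A with Base s => X s | Arr B C => dom X B -> dom X C end.

(* The name space in which all systems live: the sorts and symbols of a system
   are subsets of [tsort] and [sym]. Freshness of [dp] and of the marked symbols
   [sharp f] is [fresh_marks] below. [carrier] gives the sets interpreting the
   theory sorts (its value at other sorts is never used), and [truth] says that
   the one of [bool_sort] is {0, 1}. *)
Record universe := Universe {
  tsort : Type;
  bool_sort : tsort;
  dp : tsort;
  carrier : tsort -> Type;
  truth : bool -> carrier bool_sort;
  truth_bij : bijective truth;
  sym : Type;
  sym_ty : sym -> type tsort;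
  var : eqType;
  var_ty : var -> type tsort;
  var_infinite : forall A (l : seq var), exists x, var_ty x = A /\ x \notin l;
  sharp : sym -> sym;
  sharp_inj : injective sharp;
  sharp_ty : forall f, sym_ty (sharp f) = retarget dp (sym_ty f)
}.

Inductive term (U : universe) : Type :=
  | Var of var U
  | Sym of sym U
  | App of term U & term U.
Arguments Var {U}. Arguments Sym {U}. Arguments App {U}.

Section Terms.
Context {U : universe}.
Implicit Types (t u : term U).

Inductive has_type : term U -> type (tsort U) -> Prop :=
  | has_type_var x : has_type (Var x) (var_ty x)
  | has_type_sym f : has_type (Sym f) (sym_ty f)
  | has_type_app t u A B :
      has_type t (Arr A B) -> has_type u A -> has_type (App t u) B.

Definition apps (t : term U) (ts : seq (term U)) : term U := foldl App t ts.

Fixpoint head t : term U := if t is App t0 _ then head t0 else t.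

Fixpoint args t : seq (term U) :=
  if t is App t0 t1 then rcons (args t0) t1 else [::].

Fixpoint FV t : seq (var U) :=
  match t with Var x => [:: x] | Sym _ => [::] | App t0 t1 => FV t0 ++ FV t1 end.

Definition ground t : Prop := FV t = [::].

Fixpoint occurs (f : sym U) t : Prop :=
  match t with
  | Var _ => False
  | Sym g => g = f
  | App t0 t1 => occurs f t0 \/ occurs f t1
  end.

Definition substitution := var U -> term U.

Fixpoint subst (s : substitution) t : term U :=
  match t with
  | Var x => s x
  | Sym f => Sym f
  | App t0 t1 => App (subst s t0) (subst s t1)
  end.

Inductive subterm : term U -> term U -> Prop :=
  | subterm_refl t : subterm t t
  | subterm_arg t0 t1 u : subterm t1 u -> subterm (App t0 t1) u
  | subterm_fun t0 t1 u : subterm t0 u -> t0 <> u -> subterm (App t0 t1) u.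

Definition strict_subterm t u : Prop := subterm t u /\ t <> u.

Definition pattern t : Prop :=
  forall u, subterm t u -> (exists x, u = Var x) \/ (exists f, head u = Sym f).

Definition terminating (r : term U -> term U -> Prop) t : Prop :=
  ~ exists q : nat -> term U, q 0 = t /\ forall i, r (q i) (q i.+1).

(* The marking f t1 ... tn |-> f# t1 ... tn. *)
Fixpoint mark t : term U :=
  match t with
  | Var x => Var x
  | Sym f => Sym (sharp f)
  | App t0 t1 => App (mark t0) t1
  end.

End Terms.
Arguments substitution : clear implicits.

Record rule (U : universe) := Rule
  { rule_l : term U; rule_r : term U; rule_c : term U }.

(* [itp f = Some d] iff [f] is a theory symbol, interpreted by [d]. *)
Record lcstrs (U : universe) := LCSTRS {
  sorts : set (tsort U);
  th_sorts : set (tsort U);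
  syms : set (sym U);
  itp : forall f : sym U, option (dom (@carrier U) (sym_ty f));
  rules : set (rule U)
}.

Section Systems.
Context {U : universe}.
Implicit Types (R : lcstrs U) (t u : term U) (s : substitution U).

Definition th_syms R : set (sym U) := [set f | itp R f <> None].

Fixpoint in_sig R t : Prop :=
  match t with
  | Var x => over_sorts (sorts R) (var_ty x)
  | Sym f => syms R f
  | App t0 t1 => in_sig R t0 /\ in_sig R t1
  end.

(* [t] is a term of type [A] over the sorts and symbols of [R]. *)
Definition wterm R t A : Prop := has_type t A /\ in_sig R t.

Definition is_subst R s : Prop :=
  forall x, over_sorts (sorts R) (var_ty x) -> wterm R (s x) (var_ty x).

Definition theory_term R t : Prop := forall f, occurs f t -> th_syms R f.

Definition theory_var R (x : var U) : Prop :=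
  exists2 A, var_ty x = Base A & th_sorts R A.

Definition value R t : Prop :=
  exists f A, [/\ t = Sym f, th_syms R f & sym_ty f = Base A].

(* [interp R t d]: the ground theory term [t] has type [A] and [[t]] = [d]. *)
Inductive interp R : term U -> forall A, dom (@carrier U) A -> Prop :=
  | interp_sym f d : itp R f = Some d -> interp R (Sym f) d
  | interp_app t u A B (g : dom (@carrier U) (Arr A B)) (d : dom (@carrier U) A) :
      interp R t g -> interp R u d -> @interp R (App t u) B (g d).

Definition holds R (c : term U) : Prop :=
  @interp R c (Base (bool_sort U)) (truth U true).

Definition constraint R (c : term U) : Prop :=
  [/\ wterm R c (Base (bool_sort U)), theory_term R c
    & forall x, x \in FV c -> theory_var R x].

Definition is_rule R (r : rule U) : Prop :=
  [/\ exists A, wterm R (rule_l r) A /\ wterm R (rule_r r) A,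
      pattern (rule_l r) /\ (exists f, head (rule_l r) = Sym f),
      exists2 f, occurs f (rule_l r) & ~ th_syms R f,
      constraint R (rule_c r)
    & forall x, x \in FV (rule_r r) -> x \notin FV (rule_l r) ->
        theory_var R x].

Definition is_lcstrs R : Prop :=
  [/\ th_sorts R `<=` sorts R /\ th_sorts R (bool_sort U),
      forall f, syms R f -> over_sorts (sorts R) (sym_ty f),
      forall f, th_syms R f ->
        syms R f /\ first_order (th_sorts R) (sym_ty f),
      forall A (d : dom (@carrier U) (Base A)), th_sorts R A ->
        exists! f, @interp R (Sym f) (Base A) d
    & rules R `<=` is_rule R].

Definition respects_rule R (r : rule U) s : Prop :=
  [/\ forall x, x \in FV (rule_c r) -> value R (s x),
      forall x, x \in FV (rule_r r) -> x \notin FV (rule_l r) -> value R (s x)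
    & holds R (subst s (rule_c r))].

(* The rewrite relation, on all terms, so that it also rewrites terms containing
   marked symbols. *)
Inductive step R : term U -> term U -> Prop :=
  | step_rule r s :
      rules R r -> (forall x, has_type (s x) (var_ty x)) ->
      respects_rule R r s ->
      step R (subst s (rule_l r)) (subst s (rule_r r))
  | step_calc f vs v A (d : dom (@carrier U) A) :
      th_syms R f -> vs <> [::] ->
      (forall i w, onth vs i = Some w -> value R w) -> value R v ->
      interp R (apps (Sym f) vs) d -> interp R v d ->
      step R (apps (Sym f) vs) v
  | step_fun t t' u : step R t t' -> step R (App t u) (App t' u)
  | step_arg t u u' : step R u u' -> step R (App t u) (App t u').

Definition steps R : term U -> term U -> Prop :=
  clos_refl_trans (term U) (step R).

Definition defined R : set (sym U) :=
  [set f | exists2 r, rules R r & head (rule_l r) = Sym f].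

Definition fresh_marks R : Prop :=
  ~ sorts R (dp U) /\ forall f, defined R f -> ~ syms R (sharp f).

Definition lcstrs_union (R0 R1 : lcstrs U) : lcstrs U := {|
  sorts := sorts R0 `|` sorts R1;
  th_sorts := th_sorts R0 `|` th_sorts R1;
  syms := syms R0 `|` syms R1;
  itp := fun f => if itp R0 f is Some d then Some d else itp R1 f;
  rules := rules R0 `|` rules R1
|}.

Definition extension (R0 R1 : lcstrs U) : Prop :=
  (forall f, th_syms R0 f -> th_syms R1 f -> itp R0 f = itp R1 f) /\
  (forall f, syms R0 f -> ~ defined R1 f).

Definition public_system (H : set (sym U)) R : Prop :=
  forall r f, rules R r -> H f ->
    [/\ ~ occurs f (rule_l r), ~ occurs f (rule_r r) & ~ occurs f (rule_c r)].

Variable (ge : tsort U -> tsort U -> Prop).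

Definition gt A B : Prop := ge A B /\ ~ ge B A.

Definition sort_ordering R : Prop :=
  [/\ forall A, sorts R A -> ge A A,
      forall A B C, sorts R A -> sorts R B -> sorts R C ->
        ge A B -> ge B C -> ge A C
    & well_founded (fun B A => [/\ sorts R A, sorts R B & gt A B])].

Fixpoint ge_pos A (B : type (tsort U)) : Prop :=
  match B with Base C => ge A C | Arr B1 B2 => gt_neg A B1 /\ ge_pos A B2 end
with gt_neg A (B : type (tsort U)) : Prop :=
  match B with Base C => gt A C | Arr B1 B2 => ge_pos A B1 /\ gt_neg A B2 end.

(* Argument positions are counted from 0 here and below. *)
Definition accessible (f : sym U) : set nat :=
  [set i | exists2 A, onth (arg_types (sym_ty f)) i = Some A
                    & ge_pos (target (sym_ty f)) A].

Definition rc_set R (I : tsort U -> set (term U)) : Prop :=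
  forall A, sorts R A ->
  [/\ forall t, I A t -> wterm R t (Base A) /\ terminating (step R) t,
      forall t u, I A t -> step R t u -> I A u
    & forall t, wterm R t (Base A) -> (exists x, head t = Var x) ->
        (forall u, step R t u -> I A u) -> I A t].

Fixpoint computable_at R (I : tsort U -> set (term U)) A t : Prop :=
  match A with
  | Base B => I B t
  | Arr B C => forall u, wterm R u B -> computable_at R I B u ->
                 computable_at R I C (App t u)
  end.

Definition computable R I t : Prop :=
  exists2 A, wterm R t A & computable_at R I A t.

Definition acc_step R I t u : Prop :=
  [/\ exists A, wterm R t (Base A), exists A, wterm R u (Base A)
    & exists f ts k tk us,
      [/\ t = apps (Sym f) ts, accessible f k, onth ts k = Some tk,
          u = apps tk us
        & forall i v, onth us i = Some v -> computable R I v]].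

(* Such an RC-set is known to exist; it is a parameter of what follows. *)
Definition computability_set R (CC : tsort U -> set (term U)) : Prop :=
  rc_set R CC /\
  forall A t, sorts R A ->
    CC A t <->
    [/\ wterm R t (Base A),
        terminating (fun u v => step R u v \/ acc_step R CC u v) t
      & forall f ts i u, steps R t (apps (Sym f) ts) ->
          accessible f i -> onth ts i = Some u -> computable R CC u].

End Systems.

(* The SDP  l# => r# [c | L], stored with its sides unmarked; [l#] is [mark l]. *)
Record sdp (U : universe) := SDP {
  sdp_l : term U;
  sdp_r : term U;
  sdp_c : term U;
  sdp_L : set (var U)
}.

Inductive flag := an | pu.

Definition problem (U : universe) : Type := (set (sdp U) * flag)%type.

Section DependencyPairs.
Context {U : universe}.
Variables (R : lcstrs U).
Implicit Types (p : sdp U) (P : set (sdp U)) (s : substitution U).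

Definition sdp_side (t : term U) : Prop :=
  [/\ exists A, wterm R t A, exists2 f, head t = Sym f & defined R f
    & has_type (mark t) (Base (dp U))].

Definition is_sdp p : Prop :=
  [/\ sdp_side (sdp_l p), sdp_side (sdp_r p), constraint R (sdp_c p),
      forall x, x \in FV (sdp_c p) -> sdp_L p x
    & forall x, sdp_L p x -> theory_var R x].

Definition respects p s : Prop :=
  [/\ is_subst R s,
      forall x, sdp_L p x -> theory_term R (s x) /\ ground (s x)
    & holds R (subst s (sdp_c p))].

(* A sequence of length [n], infinite if [n] is [None]. *)
Definition chain P (n : option nat) (c : nat -> sdp U * substitution U) : Prop :=
  let below i := if n is Some m then i < m else true in
  (forall i, below i -> P (c i).1 /\ respects (c i).1 (c i).2) /\
  (forall i, below i.+1 ->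
    steps R (subst (c i).2 (mark (sdp_r (c i).1)))
            (subst (c i.+1).2 (mark (sdp_l (c i.+1).1)))).

Definition heads P : set (sym U) :=
  [set g | exists2 p, P p & head (mark (sdp_l p)) = Sym g \/
                            head (mark (sdp_r p)) = Sym g].

Definition base_processor := set (sdp U) -> option (set (set (sdp U))).

(* [theta] only matters on [P]. *)
Definition graph_approximation P (G : finType) (e : rel G)
    (theta : sdp U -> G) : Prop :=
  forall p0 p1 s0 s1,
    chain P (Some 2) (fun i => if i is 0 then (p0, s0) else (p1, s1)) ->
    e (theta p0) (theta p1).

Definition scc (G : finType) (e : rel G) (S : set G) : Prop :=
  exists v, S = [set w | connect e v w && connect e w v].

Definition nontrivial (G : finType) (e : rel G) (S : set G) : Prop :=
  exists v w, [/\ S v, S w & e v w].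

Definition graph_processor (rho : base_processor) : Prop :=
  forall P Q, P `<=` is_sdp -> rho P = Some Q ->
  exists (G : finType) (e : rel G) (theta : sdp U -> G),
    graph_approximation P e theta /\
    Q = [set P' | exists S, [/\ scc e S, nontrivial e S
                              & P' = [set p | P p /\ S (theta p)]]].

Definition projection P (nu : sym U -> nat) : Prop :=
  forall g, heads P g -> nu g < size (arg_types (sym_ty g)).

Definition project (nu : sym U -> nat) (t : term U) : term U :=
  if head t is Sym g then nth t (args t) (nu g) else t.

Definition subterm_criterion_processor (rho : base_processor) : Prop :=
  forall P Q, P `<=` is_sdp -> rho P = Some Q ->
  exists P' nu,
    [/\ P' `<=` P /\ P' !=set0, projection P nu,
        forall p, P' p -> strict_subterm (project nu (mark (sdp_l p)))
                                         (project nu (mark (sdp_r p))),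
        forall p, P p -> ~ P' p -> project nu (mark (sdp_l p)) =
                                   project nu (mark (sdp_r p))
      & Q = [set P `\` P']].

(* [int_sort] is a theory sort of [R], interpreted as the integers via [ofz], and
   the symbols named below have their standard meaning. *)
Record int_theory := IntTheory {
  int_sort : tsort U;
  int_sort_th : th_sorts R int_sort;
  ofz : int -> carrier int_sort;
  ofz_bij : bijective ofz;
  zero_sym : sym U;
  ge_sym : sym U;
  gt_sym : sym U;
  and_sym : sym U;
  zero_symE : @interp U R (Sym zero_sym) (Base int_sort) (ofz 0%R);
  ge_symE : exists2 d,
    @interp U R (Sym ge_sym)
      (Arr (Base int_sort) (Arr (Base int_sort) (Base (bool_sort U)))) d
    & forall a b, d (ofz a) (ofz b) = truth U (b <= a)%R;
  gt_symE : exists2 d,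
    @interp U R (Sym gt_sym)
      (Arr (Base int_sort) (Arr (Base int_sort) (Base (bool_sort U)))) d
    & forall a b, d (ofz a) (ofz b) = truth U (b < a)%R;
  and_symE : exists2 d,
    @interp U R (Sym and_sym)
      (Arr (Base (bool_sort U))
        (Arr (Base (bool_sort U)) (Base (bool_sort U)))) d
    & forall a b, d (truth U a) (truth U b) = truth U (a && b)
}.

Definition theory_in (L : set (var U)) (t : term U) : Prop :=
  theory_term R t /\ forall x, x \in FV t -> L x.

Definition FI P (g : sym U) : set nat :=
  [set i | (exists2 A, onth (arg_types (sym_ty g)) i = Some (Base A)
                     & th_sorts R A) /\
    forall p t u, P p -> t = mark (sdp_l p) \/ t = mark (sdp_r p) ->
      head t = Sym g -> onth (args t) i = Some u -> theory_in (sdp_L p) u].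

(* [x g i] is the variable standing for the i-th argument of [g]. It need not be
   fresh for [P]: [J g] has no other variables and [map_int] substitutes for
   all of them at once. *)
Definition integer_mapping (Z : int_theory) P (x : sym U -> nat -> var U)
    (J : sym U -> term U) : Prop :=
  forall g, heads P g ->
  [/\ forall i A, onth (arg_types (sym_ty g)) i = Some A -> var_ty (x g i) = A,
      forall i j, i < size (arg_types (sym_ty g)) ->
        j < size (arg_types (sym_ty g)) -> x g i = x g j -> i = j,
      wterm R (J g) (Base (int_sort Z)), theory_term R (J g)
    & forall y, y \in FV (J g) -> exists2 i, FI P g i & y = x g i].

Definition map_int (x : sym U -> nat -> var U) (J : sym U -> term U)
    (t : term U) : term U :=
  if head t is Sym g then
    subst (fun y => nth (Var y) (args t)
                      (index y [seq x g i | i <- iota 0 (size (args t))])) (J g)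
  else t.

Definition entails (c d : term U) : Prop :=
  forall s, is_subst R s ->
    (forall x, x \in FV c ++ FV d -> value R (s x)) ->
    holds R (subst s c) -> holds R (subst s d).

Definition integer_mapping_processor (Z : int_theory)
    (rho : base_processor) : Prop :=
  let ge a b := App (App (Sym (ge_sym Z)) a) b in
  let gt a b := App (App (Sym (gt_sym Z)) a) b in
  let conj a b := App (App (Sym (and_sym Z)) a) b in
  forall P Q, P `<=` is_sdp -> rho P = Some Q ->
  exists P' x J,
    let Jl p := map_int x J (mark (sdp_l p)) in
    let Jr p := map_int x J (mark (sdp_r p)) in
    [/\ P' `<=` P /\ P' !=set0, integer_mapping Z P x J,
        forall p, P' p -> entails (sdp_c p)
          (conj (ge (Jl p) (Sym (zero_sym Z))) (gt (Jl p) (Jr p))),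
        forall p, P p -> ~ P' p -> entails (sdp_c p) (ge (Jl p) (Jr p))
      & Q = [set P `\` P']].

Definition processor := problem U -> option (set (problem U)).

Definition lift_processor (rho : base_processor) : processor :=
  fun pb => omap (fun Q => [set (P', an) | P' in Q]) (rho pb.1).

Variables (CC : tsort U -> set (term U)) (H : set (sym U)).

Definition public p : Prop := exists2 f, head (sdp_l p) = Sym f & ~ H f.

Definition computable_chain (n : option nat)
    (c : nat -> sdp U * substitution U) : Prop :=
  forall i u, (if n is Some m then i < m else true) ->
    strict_subterm (sdp_r (c i).1) u -> computable R CC (subst (c i).2 u).

Definition finite_problem (pb : problem U) : Prop :=
  match pb.2 with
  | an => ~ exists c, chain pb.1 None c /\ computable_chain None c
  | pu => ~ exists c, [/\ chain pb.1 None c, computable_chain None c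
                        & public (c 0).1]
  end.

Definition sound (rho : processor) : Prop :=
  forall P f Q, P `<=` is_sdp -> rho (P, f) = Some Q ->
    (forall pb, Q pb -> finite_problem pb) -> finite_problem (P, f).

Definition tau_vars (tau : sym U -> set nat) p : set (var U) :=
  [set x | exists g i u, [/\ head (mark (sdp_l p)) = Sym g, tau g i,
                             onth (args (mark (sdp_l p))) i = Some u
                           & x \in FV u]].

Definition theory_argument_mapping P (tau : sym U -> set nat) : Prop :=
  [/\ forall g i, heads P g -> tau g i ->
        exists2 A, onth (arg_types (sym_ty g)) i = Some (Base A)
                 & th_sorts R A,
      forall p g i u, P p -> head (mark (sdp_l p)) = Sym g -> tau g i ->
        onth (args (mark (sdp_l p))) i = Some u ->
        theory_in (theory_var R) u
    & forall p g j u, P p -> head (mark (sdp_r p)) = Sym g -> tau g j ->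
        onth (args (mark (sdp_r p))) j = Some u ->
        theory_in (sdp_L p `|` tau_vars tau p) u].

Definition tau_bar (tau : sym U -> set nat) p : sdp U :=
  SDP (sdp_l p) (sdp_r p) (sdp_c p) (sdp_L p `|` tau_vars tau p).

Definition fixes (tau : sym U -> set nat) P' : Prop :=
  forall p g j u x, P' p -> head (mark (sdp_r p)) = Sym g -> tau g j ->
    onth (args (mark (sdp_r p))) j = Some u -> x \in FV u -> sdp_L p x.

Definition theory_argument_processor (rho : processor) : Prop :=
  forall P f Q, P `<=` is_sdp -> rho (P, f) = Some Q ->
  exists tau P',
    [/\ theory_argument_mapping P tau, P' `<=` P /\ P' !=set0, fixes tau P'
      & match f with
        | an => Q = [set (tau_bar tau @` P, an); (P `\` P', an)]
        | pu =>
          (P `&` public `<=` P' ->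
            Q = [set ((P `&` public) `|` tau_bar tau @` (P `\` public), pu)]) /\
          (~ P `&` public `<=` P' ->
            Q = [set (tau_bar tau @` P, an); (P `\` P', pu)])
        end].

Definition covers (P2 P1 : set (sdp U)) : Prop :=
  forall p1 s1, P1 p1 -> respects p1 s1 ->
  exists p2 s2,
    [/\ P2 p2, sdp_l p2 = sdp_l p1 /\ sdp_r p2 = sdp_r p1, respects p2 s2,
        subst s1 (sdp_l p1) = subst s2 (sdp_l p1)
      & subst s1 (sdp_r p1) = subst s2 (sdp_r p1)].

Definition constraint_modification_processor (rho : processor) : Prop :=
  forall P f Q, P `<=` is_sdp -> rho (P, f) = Some Q ->
  exists P', [/\ P' `<=` is_sdp, covers P' P & Q = [set (P', f)]].

(* Defined on problems with flag [pu] only. *)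
Definition reachability_processor (rho : processor) : Prop :=
  forall P f Q, P `<=` is_sdp -> rho (P, f) = Some Q ->
  exists (G : finType) (e : rel G) (theta : sdp U -> G),
    [/\ f = pu, graph_approximation P e theta
      & Q = [set ([set p | P p /\ exists p0, [/\ P p0, public p0
                                  & connect e (theta p0) (theta p)]], pu)]].

End DependencyPairs.

(* Main.v *)
(** A marked symbol is foreign to [R], so between two consecutive SDPs of a chain
    only arguments are rewritten, each on its own. Every processor is then
    handled by cutting or relabelling an infinite chain:
    - a chain is an infinite path in a finite graph, whose tail stays in the SCC
      of a vertex visited infinitely often;
    - if the removed SDPs occur only finitely often, a tail avoids them;
      otherwise either the projected arguments, which are computable and hence
      terminate under rewriting and taking subterms, or the integer values of
      the mapped sides would decrease forever;
    - once an SDP fixed by [tau] has been used, the arguments selected by [tau]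
      are ground theory terms in all later SDPs, as rewriting preserves these. *)
From Stdlib Require Import Relation_Operators Operators_Properties ProofIrrelevance.
From mathcomp Require Import all_boot all_order ssralg ssrnum ssrint.
From mathcomp Require Import boolp classical_sets zify.
Require Import Defs.

Set Implicit Arguments.
Unset Strict Implicit.
Unset Printing Implicit Defensive.

Local Open Scope classical_set_scope.

(** * Well-founded relations and infinite sequences *)

Section AbstractReduction.
Variables (T : Type) (r : T -> T -> Prop).
Local Notation sn := (Acc (fun y x => r x y)).
Local Notation rtc := (clos_refl_trans T r).

(** A non-accessible element has a non-accessible successor, so dependent choice would yield an
    infinite sequence. *)
Lemma terminating_acc (t : T) :
  ~ (exists q : nat -> T, q 0 = t /\ forall i, r (q i) (q i.+1)) -> sn t.
Proof.
move=> tt; apply: contrapT => nt; apply: tt.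
have next (x : {x | ~ sn x}) : {y : {x | ~ sn x} | r (sval x) (sval y)}.
  apply: cid; apply: contrapT => nx; case: x nx => x xn /= nx.
  apply: xn; constructor => y xy; apply: contrapT => yn.
  by apply: nx; exists (exist _ y yn).
have [q [q0 qr]] := dependent_choice next (exist _ t nt).
by exists (fun i => sval (q i)); split => //; rewrite q0.
Qed.

Lemma acc_not_infinitely_often (q : nat -> T) :
  sn (q 0) -> (forall i, rtc (q i) (q i.+1)) ->
  (forall n, exists m, n <= m /\ exists2 y, rtc (q m) y & r y (q m.+1)) ->
  False.
Proof.
move=> q0 qr inf.
have qle n m : n <= m -> rtc (q n) (q m).
  elim: m => [|m IH]; first by rewrite leqn0 => /eqP->; apply: rt_refl.
  rewrite leq_eqVlt => /orP[/eqP->|]; first exact: rt_refl.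
  by rewrite ltnS => /IH nm; apply: rt_trans nm (qr _).
(* Generalised to every [x] from which some [q n] is reachable: one step from [x] may end inside a
   path rather than at an element of the sequence. *)
suff no x : sn x -> forall n, rtc x (q n) -> False.
  exact: no q0 0 (rt_refl _ _ _).
elim=> {}x _ IH n xn; have [m [nm [y my yS]]] := inf n.
have /(@clos_rt_rt1n _ _ _ _) xy := rt_trans _ _ _ _ _ xn
  (rt_trans _ _ _ _ _ (qle _ _ nm) my).
inversion xy as [e|z w xz zy e].
  by apply: (IH (q m.+1) _ m.+1 (rt_refl _ _ _)); rewrite e.
apply: (IH _ xz m.+1); apply: rt_trans (rt_step _ _ _ _ yS).
exact: clos_rt1n_rt.
Qed.

End AbstractReduction.

Lemma ltn_acc (n : nat) : Acc (fun y x : nat => y < x) n.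
Proof.
elim/ltn_ind: n => n IH; constructor => y; exact: IH.
Qed.

(** Nonnegativity at arbitrarily late indices passes back to all earlier ones by monotonicity, so
    the absolute values descend in the natural numbers. *)
Lemma int_not_infinitely_decreasing (z : nat -> int) :
  (forall i, (z i.+1 <= z i)%R) ->
  (forall n, exists m, n <= m /\ (0 <= z m)%R /\ (z m.+1 < z m)%R) -> False.
Proof.
move=> zle inf.
have zmono n m : n <= m -> (z m <= z n)%R.
  elim: m => [|m IH]; first by rewrite leqn0 => /eqP->.
  rewrite leq_eqVlt => /orP[/eqP->//|].
  by rewrite ltnS => /IH; apply: Order.POrderTheory.le_trans.
have z0 n : (0 <= z n)%R.
  have [m [nm [m0 _]]] := inf n.
  exact: Order.POrderTheory.le_trans m0 (zmono _ _ nm).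
have absE i : z i = Posz `|z i|%N by rewrite gez0_abs.
apply: (@acc_not_infinitely_often nat (fun x y => y < x) (fun i => `|z i|%N)).
- exact: ltn_acc.
- move=> i; have := zle i; rewrite (absE i.+1) (absE i) lez_nat.
  rewrite leq_eqVlt => /orP[/eqP->|h]; [exact: rt_refl|exact: rt_step].
- move=> n; have [m [nm [_ lt]]] := inf n; exists m; split=> //.
  exists `|z m|%N; first exact: rt_refl.
  by rewrite -ltz_nat -!absE.
Qed.

(** * Subterms, heads, arguments, typing and substitution *)

Section TermFacts.
Context {U : universe}.
Implicit Types (t u : term U) (s : substitution U).

Fixpoint term_size t : nat :=
  if t is App t0 t1 then (term_size t0 + term_size t1).+1 else 1.

Lemma term_size_gt0 t : 0 < term_size t.
Proof. by case: t. Qed.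

Lemma subterm_size t u : subterm t u -> t <> u -> term_size u < term_size t.
Proof.
move=> tu; suff [] : t = u \/ term_size u < term_size t by [].
by elim: tu => [|t0 t1 v _ [->|h]|t0 t1 v _ [->|h] _] /=; [left|right; lia..].
Qed.

Lemma subterm_trans t u v : subterm t u -> subterm u v -> subterm t v.
Proof.
move=> tu; elim: tu v => {t u} // [t0 t1 u _ IH v uv|t0 t1 u tu IH ne v uv].
  exact: subterm_arg (IH _ uv).
(* If the side condition of [subterm_fun] failed, [u] and [t0] would be subterms of each other,
   hence equal by size. *)
apply: subterm_fun (IH _ uv) _ => e; subst v.
have [e|ne'] := EM (u = t0); first by subst u.
have := subterm_size tu ne; rewrite ltnNge ltnW //; exact: subterm_size.
Qed.

(** A substitution can identify distinct terms, so the side condition of [subterm_fun] need not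
    survive by itself; the comparison of sizes does, and it excludes equality afterwards. *)
Lemma subterm_subst s t u :
  term_size u < term_size t -> subterm t u ->
  term_size (subst s u) < term_size (subst s t) /\
  subterm (subst s t) (subst s u).
Proof.
move=> lt tu; elim: tu lt => {t u} [t|t0 t1 u tu IH _|t0 t1 u tu IH ne _] /=.
- by rewrite ltnn.
- have [<-|ne] := EM (t1 = u).
    by split; [rewrite ltnS leq_addl | apply: subterm_arg; apply: subterm_refl].
  have [h1 h2] := IH (subterm_size tu ne).
  split; last exact: subterm_arg.
  by rewrite ltnS (leq_trans (ltnW h1)) // leq_addl.
- have [h1 h2] := IH (subterm_size tu ne).
  split; first by rewrite ltnS (leq_trans (ltnW h1)) // leq_addr.
  by apply: subterm_fun => // e; rewrite e ltnn in h1.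
Qed.

Lemma strict_subterm_subst s t u :
  strict_subterm t u -> strict_subterm (subst s t) (subst s u).
Proof.
case=> tu ne; have [h1 h2] := subterm_subst s (subterm_size tu ne) tu.
by split=> // e; rewrite e ltnn in h1.
Qed.

Lemma head_subst s t f : head t = Sym f -> head (subst s t) = Sym f.
Proof. by elim: t => //= g; case=> ->. Qed.

Lemma args_subst s t f :
  head t = Sym f -> args (subst s t) = [seq subst s u | u <- args t].
Proof. by elim: t => //= t0 IH t1 _ h; rewrite IH // map_rcons. Qed.

Lemma head_apps t us : head (apps t us) = head t.
Proof. by rewrite /apps; elim: us t => //= u us IH t; rewrite IH. Qed.

Lemma head_mark t f : head t = Sym f -> head (mark t) = Sym (sharp f).
Proof. by elim: t => //= g; case=> ->. Qed.

Lemma args_mark t : args (mark t) = args t.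
Proof. by elim: t => //= t0 -> t1. Qed.

Lemma subst_mark s t f : head t = Sym f -> subst s (mark t) = mark (subst s t).
Proof. by elim: t => //= t0 IH t1 _ h; rewrite IH. Qed.

Lemma onth_rcons (T : Type) (l : seq T) x i :
  onth (rcons l x) i =
  if i < size l then onth l i else if i == size l then Some x else None.
Proof. by rewrite !onthE map_rcons nth_rcons size_map. Qed.

Lemma onth_size (T : Type) (l : seq T) x i : onth l i = Some x -> i < size l.
Proof. by rewrite -onthTE => ->. Qed.

Lemma onth_args_subterm t i u : onth (args t) i = Some u -> strict_subterm t u.
Proof.
have app_arg t0 t1 v : subterm t1 v -> strict_subterm (App t0 t1) v.
  move=> tv; split; first exact: subterm_arg.
  move=> e; have [e'|ne] := EM (t1 = v).
    by have := congr1 term_size e; rewrite e' /=; lia.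
  by have := subterm_size tv ne; rewrite -e /=; lia.
elim: t => [?|?|t0 IH t1 _] /=; rewrite ?onth0n // onth_rcons; case: ifP => _.
  move=> /IH[h ne]; split; first by apply: subterm_fun.
  by move=> e; have := subterm_size h ne; rewrite -e /=; lia.
by case: ifP => // _ [->]; apply: app_arg; apply: subterm_refl.
Qed.

Lemma has_type_fun t A B : has_type t A -> has_type t B -> A = B.
Proof.
move=> h; elim: h B => {t A} [x|f|t u A B _ IHt _ _] C h.
- by inversion h.
- by inversion h.
- by inversion h as [| |t' u' A' B' h1 h2]; case: (IHt _ h1).
Qed.

Lemma has_type_args t A g : has_type t A -> head t = Sym g ->
  exists Bs, [/\ arg_types (sym_ty g) = Bs ++ arg_types A,
    size Bs = size (args t)
  & forall i u, onth (args t) i = Some u ->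
      exists2 B, onth Bs i = Some B & has_type u B].
Proof.
elim=> {t A} [x //|f [<-]|t u A B _ IH uA _ /= /IH[Bs [e1 e2 e3]]].
  by exists [::]; split=> [||i u /=]; rewrite ?cat0s ?onth0n.
exists (rcons Bs A); rewrite e1 cat_rcons !size_rcons e2; split=> // i v.
rewrite !onth_rcons e2; case: ifP => _; first exact: e3.
by case: ifP => // _ [<-]; exists A.
Qed.

Lemma has_type_base_args t a g : has_type t (Base a) -> head t = Sym g ->
  size (args t) = size (arg_types (sym_ty g)) /\
  forall i u, onth (args t) i = Some u ->
      exists2 B, onth (arg_types (sym_ty g)) i = Some B & has_type u B.
Proof.
move=> h hd; have [Bs [e1 e2 e3]] := has_type_args h hd.
by rewrite e1 cats0 e2.
Qed.

Lemma has_type_subst s t A :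
  has_type t A -> (forall x, x \in FV t -> has_type (s x) (var_ty x)) ->
  has_type (subst s t) A.
Proof.
elim=> {t A} [x h|f _|t u A B _ IH1 _ IH2 h] /=.
- by apply: h; rewrite inE.
- exact: has_type_sym.
- apply: has_type_app (IH1 _) (IH2 _) => x xt; apply: h;
  by rewrite mem_cat xt ?orbT.
Qed.

Lemma subst_eq_FV s s' t x : subst s t = subst s' t -> x \in FV t -> s x = s' x.
Proof.
elim: t => //= [y|t0 IH0 t1 IH1]; first by rewrite inE => e /eqP->.
by case=> e0 e1; rewrite mem_cat => /orP[/(IH0 e0)|/(IH1 e1)].
Qed.

Lemma eq_subst s s' t : {in FV t, s =1 s'} -> subst s t = subst s' t.
Proof.
elim: t => //= [y|t0 IH0 t1 IH1] h; first by apply: h; rewrite inE.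
by rewrite IH0 ?IH1 // => x xt; apply: h; rewrite mem_cat xt ?orbT.
Qed.

Lemma subterm_FV t u x : subterm t u -> x \in FV u -> x \in FV t.
Proof.
by elim=> {t u} // t0 t1 u _ IH => [|_] /IH /=; rewrite mem_cat => ->; rewrite ?orbT.
Qed.

Lemma mem_FV_subst s t y :
  (y \in FV (subst s t)) <-> exists2 x, x \in FV t & y \in FV (s x).
Proof.
elim: t => [x|f|t0 IH0 t1 IH1] /=.
- by split=> [h|[z]]; [exists x; rewrite ?inE | rewrite inE => /eqP->].
- by split=> // -[].
rewrite mem_cat; split.
  by case/orP=> [/IH0|/IH1] [x h1 h2]; exists x => //; rewrite mem_cat h1 ?orbT.
case=> x; rewrite mem_cat => /orP[] h1 h2; apply/orP.
  by left; apply/IH0; exists x.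
by right; apply/IH1; exists x.
Qed.

Lemma subst_comp s s' t : subst s (subst s' t) = subst (fun x => subst s (s' x)) t.
Proof. by elim: t => //= t0 -> t1 ->. Qed.

Lemma occurs_subst s t f :
  occurs f (subst s t) <->
  occurs f t \/ exists2 x, x \in FV t & occurs f (s x).
Proof.
elim: t => [x|g|t0 IH0 t1 IH1] /=.
- split=> [h|[//|[y]]]; first by right; exists x; rewrite ?inE.
  by rewrite inE => /eqP->.
- by split=> [->|[//|[]//]]; left.
split.
  case=> [/IH0|/IH1] [|[x h1 h2]]; try tauto; right; exists x => //;
  by rewrite mem_cat h1 ?orbT.
case=> [[h|h]|[x]]; [left; apply/IH0|right; apply/IH1|]; try tauto.
rewrite mem_cat => /orP[] h1 h2; [left; apply/IH0|right; apply/IH1]; right;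
by exists x.
Qed.

End TermFacts.

(** * Terms over the signature of a system *)

Section Rewriting.
Context {U : universe} (R : lcstrs U).
Hypothesis R_lcstrs : is_lcstrs R.
Implicit Types (t u : term U) (s : substitution U).

Lemma th_syms_in_syms f : th_syms R f -> syms R f.
Proof. by case: R_lcstrs => _ _ h _ _ /h[]. Qed.

Lemma th_sorts_in_sorts A : th_sorts R A -> sorts R A.
Proof. by case: R_lcstrs => -[h _] _ _ _ _; apply: h. Qed.

Lemma theory_var_over_sorts x : theory_var R x -> over_sorts (sorts R) (var_ty x).
Proof. by case=> A -> /th_sorts_in_sorts. Qed.

Lemma in_sig_head t f : in_sig R t -> head t = Sym f -> syms R f.
Proof. by elim: t => //= [g h [<-]//|t0 IH t1 _ [h _]]; apply: IH. Qed.

Lemma rule_head r : rules R r ->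
  exists2 f, head (rule_l r) = Sym f & syms R f.
Proof.
case: R_lcstrs => _ _ _ _ h /h[[A [[_ sig] _]] [_ [f hf]] _ _ _].
by exists f => //; apply: in_sig_head hf.
Qed.

Lemma in_sig_subst s t : in_sig R t -> (forall x, x \in FV t -> in_sig R (s x)) ->
  in_sig R (subst s t).
Proof.
elim: t => //= [x _ h|t0 IH0 t1 IH1 [h0 h1] h]; first by apply: h; rewrite inE.
by split; [apply: IH0|apply: IH1] => // x xt; apply: h; rewrite mem_cat xt ?orbT.
Qed.

Lemma in_sig_subst_var s t x : in_sig R (subst s t) -> x \in FV t -> in_sig R (s x).
Proof.
elim: t => //= [y h|t0 IH0 t1 IH1 [h0 h1]]; first by rewrite inE => /eqP->.
by rewrite mem_cat => /orP[]; [apply: IH0|apply: IH1].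
Qed.

Lemma value_in_sig t : value R t -> in_sig R t.
Proof. by case=> f [A [-> h _]] /=; apply: th_syms_in_syms. Qed.

Lemma wterm_over_sorts t A : wterm R t A -> over_sorts (sorts R) A.
Proof.
case; elim=> {t A} [x|f|t u A B _ IH _ _ /= [h _]] //=.
  by case: R_lcstrs => _ h _ _ _; apply: h.
by case: (IH h).
Qed.

(** * Interpretation of theory terms and its invariance under rewriting *)

Lemma interp_has_type t A d : @interp U R t A d -> has_type t A.
Proof.
elim=> {t A d} [f d _|t u A B g d _ h1 _ h2]; first exact: has_type_sym.
exact: has_type_app h1 h2.
Qed.

Lemma interp_theory t A d : @interp U R t A d -> theory_term R t /\ ground t.
Proof.
rewrite /ground; elim=> {t A d} [f d h|t u A B g d _ [h1 e1] _ [h2 e2]].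
  by split=> // g /= <-; rewrite /th_syms /= h.
by split=> [f [/h1|/h2]|] //=; rewrite e1 e2.
Qed.

(** [interp] is indexed by a type and an element depending on it, so the inversion is stated by
    matching on the term. In the symbol case elements are compared as dependent pairs, because [A]
    is not syntactically the type of the symbol. *)
Lemma interp_inv t A (d : dom (@carrier U) A) : interp R t d ->
  match t with
  | Var _ => False
  | Sym f => exists2 d', itp R f = Some d'
               & existT (dom (@carrier U)) _ d' = existT _ A d
  | App t u => exists B (g : dom (@carrier U) (Arr B A)) (e : dom (@carrier U) B),
      [/\ interp R t g, interp R u e & d = g e]
  end.
Proof.
by case=> {t A d} [f d e|t u A B g d h1 h2]; [exists d | exists A, g, d].
Qed.

(** Types and elements are compared together: in an application the two interpretations may a priori
    use different argument types, and these must agree before the elements can be compared. *)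
Lemma interp_inj t A A' (d : dom (@carrier U) A) (d' : dom (@carrier U) A') :
  interp R t d -> interp R t d' ->
  existT (dom (@carrier U)) A d = existT (dom (@carrier U)) A' d'.
Proof.
move=> h; elim: h A' d' => {t A d} [f d e|t u A B g d _ IH1 _ IH2] A' d' /interp_inv.
  by case=> d2; rewrite e => -[<-].
case=> A2 [g2 [d2 [h1 h2 ->]]].
have eg := IH1 _ _ h1; have ed := IH2 _ _ h2.
case: (projT1_eq eg) => /= eA eB; subst A2 A'.
by rewrite (inj_pair2 _ _ _ _ _ eg) (inj_pair2 _ _ _ _ _ ed).
Qed.

Lemma interp_uniq t A d d' : @interp U R t A d -> @interp U R t A d' -> d = d'.
Proof. by move=> h h'; apply: inj_pair2 (interp_inj h h'). Qed.

(** No rule applies inside an interpreted term, because left-hand sides contain a non-theory symbol;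
    calculation steps preserve the value by definition. *)
Lemma interp_step t t' A d : step R t t' -> @interp U R t A d -> @interp U R t' A d.
Proof.
move=> st; elim: st A d => {t t'}
  [r s rr _ _|f vs v A d _ _ _ _ h1 h2|t t' u _ IH|t u u' _ IH] B e h.
- have [] := interp_theory h; case: R_lcstrs => _ _ _ _ /(_ _ rr)[_ _ [f fl nf] _ _].
  by move=> /(_ f); rewrite occurs_subst => th _; case: nf; apply: th; left.
- have E := interp_inj h1 h; have /= eA := projT1_eq E; subst B.
  by rewrite -(inj_pair2 _ _ _ _ _ E).
- have [C [g [d [h1 h2 ->]]]] := interp_inv h.
  exact: interp_app (IH _ _ h1) h2.
- have [C [g [d [h1 h2 ->]]]] := interp_inv h.
  exact: interp_app h1 (IH _ _ h2).
Qed.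

Lemma interp_steps t t' A (d : dom (@carrier U) A) :
  steps R t t' -> interp R t d -> interp R t' d.
Proof.
by move=> st; elim: st d => {t t'} [t t' /interp_step st d /st|//|t u v _ h1 _ h2 d /h1/h2].
Qed.

Lemma interp_subst_mono s s' t A (d : dom (@carrier U) A) :
  (forall x B (e : dom (@carrier U) B), x \in FV t ->
     interp R (s x) e -> interp R (s' x) e) ->
  interp R (subst s t) d -> interp R (subst s' t) d.
Proof.
elim: t A d => [x|f|t IH1 u IH2] A d h //=; first by apply: h; rewrite inE.
move=> /interp_inv[B [g [e [h1 h2 ->]]]]; apply: interp_app.
  by apply: IH1 h1 => x C f xt; apply: h; rewrite mem_cat xt.
by apply: IH2 h2 => x C f xt; apply: h; rewrite mem_cat xt orbT.
Qed.

Lemma interp_subst_exists s t A :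
  has_type t A -> theory_term R t ->
  (forall x, x \in FV t -> exists d : dom (@carrier U) (var_ty x), interp R (s x) d) ->
  exists d : dom (@carrier U) A, interp R (subst s t) d.
Proof.
elim=> {t A} [x _ h|f th _|t u A B _ IH1 _ IH2 th h] /=.
- by apply: h; rewrite inE.
- have := th f erefl; rewrite /th_syms /=; case e: (itp R f) => [d|//] _.
  by exists d; apply: interp_sym.
have [||g hg] := IH1; first by move=> f ft; apply: th; left.
  by move=> x xt; apply: h; rewrite mem_cat xt.
have [||e he] := IH2; first by move=> f ft; apply: th; right.
  by move=> x xt; apply: h; rewrite mem_cat xt orbT.
by exists (g e); apply: interp_app.
Qed.

Lemma interp_ground_theory t A : has_type t A -> theory_term R t -> ground t ->
  exists d : dom (@carrier U) A, interp R t d.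
Proof.
move=> tA th gr; have [|d] := interp_subst_exists (s := Var) tA th.
  by rewrite gr.
suff -> : subst Var t = t by exists d.
by elim: t {tA th gr} => //= t0 -> t1 ->.
Qed.

(** The surjective half of the bijection between values and carriers; it lets ground theory terms be
    replaced by values. *)
Lemma interp_value A (d : dom (@carrier U) (Base A)) : th_sorts R A ->
  exists v, [/\ value R v, wterm R v (Base A) & interp R v d].
Proof.
case: R_lcstrs => _ _ _ h _ /(h A d)[f [hf _]]; exists (Sym f).
have ty := interp_has_type hf.
have [th _] := interp_theory hf.
split=> //; last by split=> //=; apply/th_syms_in_syms/th.
exists f, A; split=> //; first exact: th.
exact: has_type_fun (has_type_sym f) ty.
Qed.

(** Only calculation steps can occur inside such a term, and these produce values. *)
Lemma step_ground_theory t t' : step R t t' ->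
  theory_term R t -> ground t -> theory_term R t' /\ ground t'.
Proof.
elim=> {t t'}
  [r s rr _ _ th|f vs v A d _ _ _ vv _ _ _ _|t t' u _ IH th gr|t u u' _ IH th gr].
- case: R_lcstrs => _ _ _ _ /(_ _ rr)[_ _ [f fl nf] _ _].
  by case: nf; apply: th; rewrite occurs_subst; left.
- by case: vv => g [B [-> h _]]; split=> // h' /= <-.
- have [gt gu] : FV t = [::] /\ FV u = [::].
    by move: gr; rewrite /ground /=; case: (FV t) => //=; case: (FV u).
  have [f ft|th' gr'] := IH _ gt; first by apply: th; left.
  split=> [f /= [|fu]|]; [exact: th'|by apply: th; right|].
  by rewrite /ground /= gr' gu.
- have [gt gu] : FV t = [::] /\ FV u = [::].
    by move: gr; rewrite /ground /=; case: (FV t) => //=; case: (FV u).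
  have [f ft|th' gr'] := IH _ gu; first by apply: th; right.
  split=> [f /= [ft|]|]; [by apply: th; left|exact: th'|].
  by rewrite /ground /= gr' gt.
Qed.

Lemma steps_ground_theory t t' : steps R t t' ->
  theory_term R t /\ ground t -> theory_term R t' /\ ground t'.
Proof.
by elim=> {t t'} [t t' /step_ground_theory st []//|//|t u v _ h1 _ h2 /h1/h2].
Qed.

Lemma ground_theory_subst s t : theory_term R t ->
  (forall x, x \in FV t -> theory_term R (s x) /\ ground (s x)) ->
  theory_term R (subst s t) /\ ground (subst s t).
Proof.
move=> th h; split=> [f /occurs_subst[/th//|[x /h[]]]|]; first by move=> h' _ /h'.
rewrite /ground; case e: (FV _) => [//|y l].
have : y \in FV (subst s t) by rewrite e inE eqxx.
by case/mem_FV_subst => x /h[_ ->].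
Qed.

Lemma ground_theory_subst_var s t x : x \in FV t ->
  theory_term R (subst s t) /\ ground (subst s t) ->
  theory_term R (s x) /\ ground (s x).
Proof.
move=> xt [th gr]; split=> [f fx|].
  by apply: th; rewrite occurs_subst; right; exists x.
rewrite /ground; case e: (FV _) => [//|y l].
have : y \in FV (subst s t) by rewrite mem_FV_subst; exists x; rewrite // e inE eqxx.
by rewrite gr.
Qed.

(** * Typing under rewriting, and terms with a foreign head *)

Lemma step_wterm t t' : step R t t' -> forall A, wterm R t A -> wterm R t' A.
Proof.
elim=> {t t'} [r s rr st [_ sv _] A|f vs v A d _ _ _ vv h1 h2 B|
               t t' u _ IH A|t u u' _ IH A] [ty sig].
- case: R_lcstrs => _ _ _ _ /(_ _ rr)[[B [[lB _] [rB rsig]]] _ _ _ _].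
  have eAB : A = B by apply: has_type_fun ty _; apply: has_type_subst lB _ => x _.
  rewrite eAB; split; first by apply: has_type_subst rB _ => x _.
  apply: in_sig_subst rsig _ => x xr.
  (* [step] does not ask the substitution to stay in the signature: on variables of the left-hand
     side it does because the redex does, on the others because they are mapped to values. *)
  have [xl|xl] := boolP (x \in FV (rule_l r)); first exact: in_sig_subst_var sig xl.
  exact/value_in_sig/sv.
- split; last exact: value_in_sig.
  by rewrite (has_type_fun ty (interp_has_type h1)); apply: interp_has_type h2.
- inversion ty as [| |t0 u0 B C tB uB]; case: sig => st su.
  have [t'B st'] := IH _ (conj tB st).
  by split; [apply: has_type_app t'B uB | split].
- inversion ty as [| |t0 u0 B C tB uB]; case: sig => st su.
  have [u'B su'] := IH _ (conj uB su).
  by split; [apply: has_type_app tB u'B | split].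
Qed.

(** Every redex is headed by a symbol of the signature, so neither the term nor a prefix of its
    spine is a redex. *)
Lemma step_foreign_head h t t' : ~ syms R h -> head t = Sym h -> step R t t' ->
  [/\ head t' = Sym h, size (args t') = size (args t)
    & forall i u', onth (args t') i = Some u' ->
        exists2 u, onth (args t) i = Some u & steps R u u'].
Proof.
move=> nh + st; elim: st => {t t'}
  [r s rr _ _|f vs v A d th _ _ _ _ _|t t' u _ IH /= ht|t u u' st _ /= ht].
- have [f hf sf] := rule_head rr; rewrite (head_subst s hf) => -[e].
  by case: nh; rewrite -e.
- by rewrite head_apps /= => -[e]; case: nh; rewrite -e; apply: th_syms_in_syms.
- have [h1 h2 h3] := IH ht; split=> //; first by rewrite !size_rcons h2.
  move=> i v; rewrite !onth_rcons h2; case: ifP => _; first exact: h3.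
  by case: ifP => // _ ->; exists v => //; apply: rt_refl.
- split=> //; first by rewrite !size_rcons.
  move=> i v; rewrite !onth_rcons; case: ifP => _.
    by move=> e; exists v => //; apply: rt_refl.
  by case: ifP => // _ [<-]; exists u => //; apply: rt_step.
Qed.

Lemma steps_foreign_head h t t' : ~ syms R h -> head t = Sym h -> steps R t t' ->
  [/\ head t' = Sym h, size (args t') = size (args t)
    & forall i u', onth (args t') i = Some u' ->
        exists2 u, onth (args t) i = Some u & steps R u u'].
Proof.
move=> nh + st; elim: st => {t t'} [t t' st ht|t ht|t u v _ IH1 _ IH2 ht].
- exact: step_foreign_head st.
- by split=> // i u' e; exists u' => //; apply: rt_refl.
- have [h1 s1 a1] := IH1 ht; have [h2 s2 a2] := IH2 h1.
  split=> //; first by rewrite s2.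
  move=> i w /a2[w' /a1[w'' e r1] r2]; exists w'' => //; exact: rt_trans r1 r2.
Qed.

(** * Strong normalisation and computability *)

Local Notation sn := (Acc (fun u t => step R t u)).

Lemma sn_app_fun t u : sn (App t u) -> sn t.
Proof.
move E: (App t u) => v h; elim: h t u E => {}v _ IH t u e.
by constructor => t' st; apply: (IH (App t' u) _ t' u erefl); rewrite -e; apply: step_fun.
Qed.

Lemma step_app_neutral t u v x : head t = Var x -> step R (App t u) v ->
  (exists2 t', v = App t' u & step R t t') \/
  (exists2 u', v = App t u' & step R u u').
Proof.
move=> ht; move E: (App t u) => w st.
case: st E => {w v} [r s rr _ _|f vs v A d _ _ _ _ _ _|t0 t' u0 st|t0 u0 u' st] e.
- have [f hf _] := rule_head rr.
  by have := head_subst s hf; rewrite -e /= ht.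
- by have := head_apps (Sym f) vs; rewrite -e /= ht.
- by case: e => -> ->; left; exists t'.
- by case: e => -> ->; right; exists u'.
Qed.

(** The size clause serves the induction: it shows that the side condition of [subterm_fun] still
    holds after the step. *)
Lemma subterm_step t u u' : subterm t u -> step R u u' ->
  exists t', [/\ step R t t', subterm t' u'
               & t <> u -> term_size u' < term_size t'].
Proof.
have size_le (v w : term U) : subterm v w -> term_size w <= term_size v.
  by have [->//|ne] := EM (v = w); move=> /subterm_size/(_ ne)/ltnW.
move=> tu; elim: tu u' => {t u} [t u' st|t0 t1 u _ IH u'|t0 t1 u _ IH ne u'].
- by exists u'; split=> //; apply: subterm_refl.
- move=> /IH[t' [st sb _]]; exists (App t0 t').
  split; [exact: step_arg|exact: subterm_arg|move=> _ /=].
  by have := size_le _ _ sb; lia.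
- move=> /IH[t' [st sb /(_ ne) lt]]; exists (App t' t1).
  split; [exact: step_fun| |by move=> _ /=; lia].
  by apply: subterm_fun => // e; rewrite e ltnn in lt.
Qed.

(** Induction on [t] under rewriting, and inside it on the size of a subterm [u]: a step of [u]
    lifts to a step of [t], while a strict subterm of [u] is smaller. *)
Lemma sn_step_or_subterm t : sn t ->
  Acc (fun v u => step R u v \/ strict_subterm u v) t.
Proof.
suff h : sn t -> forall u, subterm t u ->
    Acc (fun v u => step R u v \/ strict_subterm u v) u.
  by move=> /h; apply; apply: subterm_refl.
elim=> {}t _ IH u; move: {2}(term_size u) (leqnn (term_size u)) => n.
elim: n u => [|n IHn] u; first by have := term_size_gt0 u; lia.
move=> le tu; constructor => v [st|[uv ne]].
  by have [t' [st' sb _]] := subterm_step tu st; apply: IH st' _ sb.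
apply: IHn; last exact: subterm_trans tu uv.
by have := subterm_size uv ne; lia.
Qed.

Variable CC : tsort U -> set (term U).
Hypothesis CC_rc : rc_set R CC.

Lemma computable_at_step A t u : over_sorts (sorts R) A ->
  computable_at R CC A t -> step R t u -> computable_at R CC A u.
Proof.
elim: A t u => [a|B _ C IH] t u /= hA.
  by case: (CC_rc hA) => _ h _; apply: h.
move=> h st v wv cv; apply: IH (h v wv cv) _; first by case: hA.
exact: step_fun.
Qed.

(** Both halves are proved together, as in Tait's method: termination at an arrow type applies the
    term to a variable, computable by the second half, and the second half needs computable
    arguments to terminate. *)
Lemma computable_at_sn_neutral A : over_sorts (sorts R) A ->
  (forall t, wterm R t A -> computable_at R CC A t -> sn t) /\
  (forall t, wterm R t A -> (exists x, head t = Var x) ->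
     (forall u, step R t u -> computable_at R CC A u) -> computable_at R CC A t).
Proof.
elim: A => [a|B IHB C IHC] /= hA.
  case: (CC_rc hA) => h1 _ h3; split; last exact: h3.
  by move=> t _ ct; have [_ tt] := h1 t ct; apply: terminating_acc tt.
case: hA => hB hC.
have [snB neB] := IHB hB; have [snC neC] := IHC hC.
have appw t u : wterm R t (Arr B C) -> wterm R u B -> wterm R (App t u) C.
  by case=> ty sg [ty' sg']; split; [apply: has_type_app ty ty'|split].
split=> [t wt ct|t wt [x hx] ct u wu cu].
  have [x [xB _]] := var_infinite (u := U) B [::].
  have wx : wterm R (Var x) B.
    by split; [rewrite -xB; apply: has_type_var | rewrite /= xB].
  apply: (@sn_app_fun t (Var x)); apply: snC; first exact: appw.
  apply: ct => //; apply: neB => //; first by exists x.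
  move=> u st; exfalso; move E: (Var x) st => w st.
  case: st E => {w u} [r s rr _ _|f vs v A d _ _ _ _ _ _|//|//] e.
    by have [f hf _] := rule_head rr; have := head_subst s hf; rewrite -e.
  by have := head_apps (Sym f) vs; rewrite -e.
(* Induction on the termination of the argument, since a step of [App t u] may take place in [u]. *)
have su := snB _ wu cu; elim: su wu cu => {}u _ IH wu cu.
apply: neC; [exact: appw|by exists x|move=> v st].
have [[t' -> st']|[u' -> st']] := step_app_neutral hx st; first exact: ct.
by apply: IH => //; [apply: step_wterm st' _ wu | apply: computable_at_step cu st'].
Qed.

Lemma computable_sn t : computable R CC t -> sn t.
Proof.
case=> A wt ct; have [h _] := computable_at_sn_neutral (wterm_over_sorts wt).
exact: h.
Qed.

End Rewriting.

(** Otherwise each vertex has a bound beyond which it is not visited, and the vertex visited at the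
    largest bound contradicts its own. *)
Lemma fin_infinitely_often (G : finType) (q : nat -> G) :
  exists v, forall n, exists2 m, n <= m & q m = v.
Proof.
apply: contrapT => no.
have {}no v : exists n, forall m, n <= m -> q m <> v.
  apply: contrapT => nv; apply: no; exists v => n; apply: contrapT => nn.
  by apply: nv; exists n => m nm e; apply: nn; exists m.
have [N hN] := choice no.
pose M := \max_v N v.
by apply: (hN (q M) M) => //; apply: leq_bigmax.
Qed.

(** * Chains, and processors lifted from sets of SDPs *)

Section Processors.
Context {U : universe} (R : lcstrs U) (CC : tsort U -> set (term U)).
Context (H : set (sym U)).
Hypotheses (R_lcstrs : is_lcstrs R) (R_fresh : fresh_marks R).
Hypothesis CC_rc : rc_set R CC.
Implicit Types (p : sdp U) (P : set (sdp U)) (s : substitution U).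
Implicit Types (c : nat -> sdp U * substitution U).

Lemma chain_tail P c n : chain R P None c -> chain R P None (fun i => c (n + i)).
Proof. by case=> h1 h2; split=> i _; rewrite ?addnS; [apply: h1|apply: h2]. Qed.

Lemma computable_chain_tail c n :
  computable_chain R CC None c -> computable_chain R CC None (fun i => c (n + i)).
Proof. by move=> h i u _; apply: h. Qed.

Lemma chain_in P P' c : chain R P None c -> (forall i, P' (c i).1) ->
  chain R P' None c.
Proof. by case=> h1 h2 h; split=> i _; [split=> //; apply h1|apply: h2]. Qed.

Lemma sdp_side_head t : sdp_side R t ->
  exists f, head (mark t) = Sym (sharp f) /\ ~ syms R (sharp f).
Proof.
case=> _ [f hf df] _; exists f; split; first exact: head_mark.
by case: R_fresh => _; apply.
Qed.

(** The arguments are taken before substitution because projections, integer mappings and theory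
    argument mappings are all defined on the sides of SDPs. *)
Lemma chain_link P c i : P `<=` is_sdp R -> chain R P None c ->
  exists h, [/\ head (mark (sdp_r (c i).1)) = Sym h,
    head (mark (sdp_l (c i.+1).1)) = Sym h
  & forall j u', onth (args (mark (sdp_l (c i.+1).1))) j = Some u' ->
      exists2 u, onth (args (mark (sdp_r (c i).1))) j = Some u
               & steps R (subst (c i).2 u) (subst (c i.+1).2 u')].
Proof.
move=> Psdp [cP cs].
have [/Psdp[_ side_r _ _ _] _] := cP i isT.
have [/Psdp[side_l _ _ _ _] _] := cP i.+1 isT.
have [f [hf nf]] := sdp_side_head side_r; have [g [hg _]] := sdp_side_head side_l.
have hf' := head_subst (c i).2 hf; have hg' := head_subst (c i.+1).2 hg.
have [] := steps_foreign_head R_lcstrs nf hf' (cs i isT).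
rewrite hg' => -[e] _ h; exists (sharp f); split=> //; first by rewrite hg e.
move=> j u' hu'; have [|v] := h j (subst (c i.+1).2 u').
  by rewrite (args_subst _ hg) onth_map hu'.
by rewrite (args_subst _ hf) onth_map; case: onth => //= u [<-]; exists u.
Qed.

Lemma chain_heads P c i h : chain R P None c ->
  head (mark (sdp_r (c i).1)) = Sym h -> heads P h.
Proof. by case=> cP _ e; exists (c i).1; [apply cP|right]. Qed.

Lemma finite_an P f : finite_problem R CC H (P, an) -> finite_problem R CC H (P, f).
Proof. by case: f => // h [c [h1 h2 _]]; apply: h; exists c. Qed.

(** The output carries the flag [an] whatever the input flag is, and a public chain is in particular
    a chain, so the input flag [an] is the only case to treat. *)
Lemma lift_processor_sound (rho : base_processor) :
  (forall P Q, P `<=` is_sdp R -> rho P = Some Q ->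
     (forall P', Q P' -> finite_problem R CC H (P', an)) ->
     finite_problem R CC H (P, an)) ->
  sound R CC H (lift_processor rho).
Proof.
move=> h P f Q Psdp; rewrite /lift_processor /=.
case e: (rho P) => [Q'|//] /= [<-] fin; apply/finite_an/(h P Q' Psdp e) => P' QP'.
by apply: fin; exists P'.
Qed.

Lemma removed_infinitely_often P P' c :
  chain R P None c -> computable_chain R CC None c ->
  finite_problem R CC H (P `\` P', an) ->
  forall n, exists2 m, n <= m & P' (c m).1.
Proof.
move=> ch co fin n; apply: contrapT => no; apply: fin.
exists (fun i => c (n + i)); split; last exact: computable_chain_tail.
apply: chain_in (chain_tail n ch) _ => i; split; first by apply (ch.1 _ isT).
by move=> h; apply: no; exists (n + i); rewrite ?leq_addr.
Qed.

(** * Chains as paths in a graph approximation *)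

Lemma chain_edge P c (G : finType) (e : rel G) theta i :
  graph_approximation R P e theta -> chain R P None c ->
  e (theta (c i).1) (theta (c i.+1).1).
Proof.
move=> ga [cP cs]; apply: (ga _ _ (c i).2 (c i.+1).2); split.
  by case=> [|[|//]] _ /=; apply: cP.
by case=> [|//] _ /=; apply: cs.
Qed.

Lemma chain_connect P c (G : finType) (e : rel G) theta i j :
  graph_approximation R P e theta -> chain R P None c -> i <= j ->
  connect e (theta (c i).1) (theta (c j).1).
Proof.
move=> ga ch; elim: j => [|j IH]; first by rewrite leqn0 => /eqP->.
rewrite leq_eqVlt => /orP[/eqP->//|]; rewrite ltnS => /IH h.
by apply: connect_trans h (connect1 _); apply: chain_edge ga ch.
Qed.

Lemma graph_processor_sound rho :
  graph_processor R rho -> sound R CC H (lift_processor rho).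
Proof.
move=> gp; apply: lift_processor_sound => P Q Psdp rP fin [c [ch co]].
have [G [e [theta [ga eQ]]]] := gp P Q Psdp rP.
have [v hv] := fin_infinitely_often (fun i => theta (c i).1).
have [n _ nv] := hv 0.
pose S := [set w | connect e v w && connect e w v].
(* Reachable from [v], which is visited at [n], and leading back to [v], which is visited again
   later. *)
have inS i : S (theta (c (n + i)).1).
  apply/andP; split; first by rewrite -nv; apply: chain_connect ga ch (leq_addr _ _).
  by have [m le <-] := hv (n + i); apply: chain_connect ga ch le.
apply: (fin [set p | P p /\ S (theta p)]).
  rewrite eQ; exists S; split=> //; first by exists v.
  exists (theta (c n).1), (theta (c n.+1).1); split.
  - by have := inS 0; rewrite addn0.
  - by have := inS 1; rewrite addn1.
  - exact: chain_edge ga ch.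
exists (fun i => c (n + i)); split; last exact: computable_chain_tail.
apply: chain_in (chain_tail n ch) _ => i; split; last exact: inS.
by apply (ch.1 _ isT).
Qed.

(** * The subterm criterion *)

Lemma projectE P nu t g : projection P nu -> heads P g -> sdp_side R t ->
  head (mark t) = Sym g -> onth (args (mark t)) (nu g) = Some (project nu (mark t)).
Proof.
move=> pr hg [_ _ ty] hd; rewrite /project hd.
(* A side of sort [dp] is fully applied, so position [nu g] exists and the default of [nth] is never
   returned. *)
have [sz _] := has_type_base_args ty hd.
have := pr g hg; rewrite -sz -onthTE; case e: (onth _ _) => [u|//] _.
by rewrite (onth_nth _ _ _ _ e).
Qed.

Lemma subterm_criterion_processor_sound rho :
  subterm_criterion_processor R rho -> sound R CC H (lift_processor rho).
Proof.
move=> gp; apply: lift_processor_sound => P Q Psdp rP fin [c [ch co]].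
have [P' [nu [_ pr strict weak eQ]]] := gp P Q Psdp rP.
have inf := removed_infinitely_often ch co (fin (P `\` P') ltac:(by rewrite eQ)).
pose r (t u : term U) := step R t u \/ strict_subterm t u.
(* The sequence follows right-hand sides, since computability of a chain concerns their strict
   subterms; [ql] gives the points in between. *)
pose q i := subst (c i).2 (project nu (mark (sdp_r (c i).1))).
pose ql i := subst (c i).2 (project nu (mark (sdp_l (c i).1))).
have steps_rtc t u : steps R t u -> clos_refl_trans _ r t u.
  elim=> {t u} [t u st|t|t u v _ h1 _ h2]; [|exact: rt_refl|exact: rt_trans h1 h2].
  by apply: rt_step; left.
have side i : sdp_side R (sdp_l (c i).1) /\ sdp_side R (sdp_r (c i).1).
  by have [/Psdp[]] := ch.1 i isT.
have link i : clos_refl_trans _ r (q i) (ql i.+1).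
  have [h [hr hl args_steps]] := chain_link i Psdp ch.
  have hh := chain_heads ch hr.
  have [u] := args_steps _ _ (projectE pr hh (side i.+1).1 hl).
  by rewrite (projectE pr hh (side i).2 hr) => -[<-] st; apply: steps_rtc.
have dec i : P' (c i).1 -> r (ql i) (q i).
  by move=> h; right; apply: strict_subterm_subst; apply: strict.
apply: (@acc_not_infinitely_often _ r q).
- apply: sn_step_or_subterm; apply: (computable_sn R_lcstrs CC_rc); apply: co => //.
  have [h [hr _ _]] := chain_link 0 Psdp ch.
  have := projectE pr (chain_heads ch hr) (side 0).2 hr.
  by rewrite args_mark; apply: onth_args_subterm.
- move=> i; apply: rt_trans (link i) _.
  have [h|h] := EM (P' (c i.+1).1); first by apply: rt_step; apply: dec.
  rewrite /q /ql weak //; first exact: rt_refl.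
  by apply (ch.1 i.+1 isT).
(* Starting from [n.+1] makes the index a successor: the strict step of the SDP at [m.+1] lies
   between [q m] and [q m.+1]. *)
- move=> n; have [[//|m] nm hm] := inf n.+1; exists m; split=> //.
  by exists (ql m.+1); [apply: link | apply: dec].
Qed.

(** * Integer mappings *)

Lemma respects_interp p s x : is_sdp R p -> respects R p s -> sdp_L p x ->
  exists d : dom (@carrier U) (var_ty x), interp R (s x) d.
Proof.
move=> [_ _ _ _ Lth] [sub th _] Lx; have [h1 h2] := th x Lx.
apply: interp_ground_theory => //.
by case: (sub x (theory_var_over_sorts R_lcstrs (Lth x Lx))).
Qed.

(* [entails] quantifies over substitutions by values, whereas [respects] allows
   ground theory terms: evaluate the latter. *)
Lemma respects_value_subst p s : is_sdp R p -> respects R p s ->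
  exists s', [/\ is_subst R s', forall x, sdp_L p x -> value R (s' x)
    & forall x A (d : dom (@carrier U) A), sdp_L p x ->
        interp R (s x) d -> interp R (s' x) d].
Proof.
move=> psdp rs; have [_ _ _ _ Lth] := psdp; have [sub _ _] := rs.
have ex x : exists v, (sdp_L p x -> [/\ value R v, wterm R v (var_ty x)
    & forall A (d : dom (@carrier U) A), interp R (s x) d -> interp R v d]) /\
    (~ sdp_L p x -> v = s x).
  have [Lx|nL] := EM (sdp_L p x); last by exists (s x).
  have [d hd] := respects_interp psdp rs Lx.
  have [a ea tha] := Lth x Lx.
  move: d hd; rewrite ea => d hd.
  have [v [vv wv iv]] := interp_value R_lcstrs d tha.
  exists v; split=> // _; split=> // A e he.
  have E := interp_inj hd he; have /= eA := projT1_eq E; subst A.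
  by rewrite -(inj_pair2 _ _ _ _ _ E).
have [s' hs'] := choice ex; exists s'; split.
- move=> x ox; have [Lx|nL] := EM (sdp_L p x); first by case: ((hs' x).1 Lx).
  by rewrite (hs' x).2 //; apply: sub.
- by move=> x Lx; case: ((hs' x).1 Lx).
- by move=> x A d Lx; case: ((hs' x).1 Lx) => _ _ h; apply: h.
Qed.

(** The second conclusion carries interpretations over from [s] to [s'], so that an inequality read
    off from [d] under [s'] concerns the values taken under [s]. *)
Lemma respects_entails p s d : is_sdp R p -> respects R p s ->
  entails R (sdp_c p) d -> (forall x, x \in FV d -> sdp_L p x) ->
  exists2 s', holds R (subst s' d)
    & forall t A (e : dom (@carrier U) A), (forall x, x \in FV t -> sdp_L p x) ->
        interp R (subst s t) e -> interp R (subst s' t) e.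
Proof.
move=> psdp rs ent Ld; have [s' [sub val mono]] := respects_value_subst psdp rs.
have [_ _ _ Lc _] := psdp; have [_ _ hc] := rs.
have mono_t t A (e : dom (@carrier U) A) : (forall x, x \in FV t -> sdp_L p x) ->
    interp R (subst s t) e -> interp R (subst s' t) e.
  by move=> Lt; apply: interp_subst_mono => x B e' /Lt; apply: mono.
exists s' => //; apply: ent => //; last exact: mono_t.
by move=> x; rewrite mem_cat => /orP[/Lc|/Ld]; apply: val.
Qed.

Section IntegerMapping.
Variables (Z : int_theory R) (P : set (sdp U)).
Variables (x : sym U -> nat -> var U) (J : sym U -> term U).
Hypotheses (Psdp : P `<=` is_sdp R) (xJ : integer_mapping Z P x J).

Local Notation evaluates t z := (@interp U R t (Base (int_sort Z)) (ofz Z z)).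

Lemma evaluates_inj t z w : evaluates t z -> evaluates t w -> z = w.
Proof. by move=> h1 h2; apply: (bij_inj (ofz_bij Z)); apply: interp_uniq h1 h2. Qed.

(** The substitution written inline in [map_int]; naming it lets [subst_comp] merge it with the
    substitution of a chain. *)
Definition arg_subst (g : sym U) (t : term U) (y : var U) : term U :=
  nth (Var y) (args t) (index y [seq x g i | i <- iota 0 (size (args t))]).

Lemma map_intE t g : head t = Sym g -> map_int x J t = subst (arg_subst g t) (J g).
Proof. by rewrite /map_int => ->. Qed.

Lemma arg_substP p t g y : P p -> t = sdp_l p \/ t = sdp_r p ->
  head (mark t) = Sym g -> y \in FV (J g) ->
  exists j, [/\ y = x g j, onth (args (mark t)) j = Some (arg_subst g (mark t) y),
    has_type (arg_subst g (mark t) y) (var_ty y)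
  & theory_in R (sdp_L p) (arg_subst g (mark t) y)].
Proof.
move=> Pp tp hd yJ.
have hg : heads P g by exists p => //; case: tp hd => ->; [left|right].
have [xty xinj _ _ /(_ y yJ)[j FIj ->]] := xJ hg.
have [_ _ ty] : sdp_side R t by have [] := Psdp Pp; case: tp => ->.
have [sz argty] := has_type_base_args ty hd.
have [[A eA _] th] := FIj; have js := onth_size eA.
have jt : j < size (args (mark t)) by rewrite sz.
(* The variables [x g i] differ at distinct positions, so [index] recovers [j]. *)
have idx : index (x g j) [seq x g i | i <- iota 0 (size (args (mark t)))] = j.
  rewrite -[X in index X _](_ : nth (x g j) [seq x g i | i <- iota 0 (size (args (mark t)))] j = _).
    rewrite index_uniq ?size_map ?size_iota //.
    rewrite map_inj_in_uniq ?iota_uniq // => a b.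
    rewrite !mem_iota !add0n sz => /andP[_ ha] /andP[_ hb]; exact: xinj.
  by rewrite (nth_map 0) ?size_iota // nth_iota.
have e : onth (args (mark t)) j = Some (arg_subst g (mark t) (x g j)).
  rewrite /arg_subst idx; move: jt; rewrite -onthTE.
  by case e: (onth _ _) => [u|//] _; rewrite (onth_nth _ _ _ _ e).
exists j; split=> //.
  have [B eB uB] := argty _ _ e; by rewrite (xty _ _ eB).
apply: th Pp _ hd e; by case: tp => ->; [left|right].
Qed.

Lemma FV_map_int p t g y : P p -> t = sdp_l p \/ t = sdp_r p ->
  head (mark t) = Sym g -> y \in FV (map_int x J (mark t)) -> sdp_L p y.
Proof.
move=> Pp tp hd; rewrite (map_intE hd) => /mem_FV_subst[z zJ].
by have [j [_ _ _ [_ h]]] := arg_substP Pp tp hd zJ; apply: h.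
Qed.

Lemma map_int_evaluates p s t g : P p -> respects R p s ->
  t = sdp_l p \/ t = sdp_r p -> head (mark t) = Sym g ->
  exists z, evaluates (subst s (map_int x J (mark t))) z.
Proof.
move=> Pp rs tp hd.
have hg : heads P g by exists p => //; case: tp hd => ->; [left|right].
have [_ _ [Jty _] Jth _] := xJ hg.
rewrite (map_intE hd) subst_comp.
have [y yJ|d hd'] := interp_subst_exists
    (s := fun y => subst s (arg_subst g (mark t) y)) Jty Jth.
  have [j [_ _ ty [th L]]] := arg_substP Pp tp hd yJ.
  apply: interp_subst_exists ty th _ => z /L.
  exact: respects_interp (Psdp Pp) rs.
case: (ofz_bij Z) => f _ fK; exists (f d); by rewrite fK.
Qed.

Lemma holds_ge a b z w : evaluates a z -> evaluates b w ->
  holds R (App (App (Sym (ge_sym Z)) a) b) -> (w <= z)%R.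
Proof.
move=> ha hb h; have [d hd dE] := ge_symE Z.
have := interp_uniq h (interp_app (interp_app hd ha) hb).
by rewrite dE => /(bij_inj (truth_bij U)) <-.
Qed.

Lemma holds_gt a b z w : evaluates a z -> evaluates b w ->
  holds R (App (App (Sym (gt_sym Z)) a) b) -> (w < z)%R.
Proof.
move=> ha hb h; have [d hd dE] := gt_symE Z.
have := interp_uniq h (interp_app (interp_app hd ha) hb).
by rewrite dE => /(bij_inj (truth_bij U)) <-.
Qed.

(** Nothing is known of the arguments in advance, so the interpretation of the whole is inverted;
    bijectivity of [truth] then turns both arguments into booleans. *)
Lemma holds_and a b : holds R (App (App (Sym (and_sym Z)) a) b) ->
  holds R a /\ holds R b.
Proof.
move=> h; have [d hd dE] := and_symE Z.
have /interp_inv[B [g [e [/interp_inv[B' [g' [e' [h1 h2 h3]]]] h4 h5]]]] := h.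
have E := interp_inj hd h1; have [eB eB'] := projT1_eq E; subst B B'.
have := inj_pair2 _ _ _ _ _ E => Eg; subst g' g.
have [k kK Kk] := truth_bij U.
move: h5 h2 h4; rewrite -(Kk e) -(Kk e') dE => /(bij_inj (truth_bij U)).
by case: (k e') (k e) => [] [].
Qed.

(** Both sides have the same head and hence the same [J]; their arguments differ by rewriting only,
    which preserves interpretations. *)
Lemma chain_evaluates c i z w : chain R P None c ->
  evaluates (subst (c i).2 (map_int x J (mark (sdp_r (c i).1)))) w ->
  evaluates (subst (c i.+1).2 (map_int x J (mark (sdp_l (c i.+1).1)))) z ->
  w = z.
Proof.
move=> ch hw hz; have [h [hr hl args_steps]] := chain_link i Psdp ch.
have [Pr rr] := ch.1 i isT; have [Pl rl] := ch.1 i.+1 isT.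
move: hw hz; rewrite (map_intE hr) (map_intE hl) !subst_comp => hw hz.
apply: evaluates_inj hz; apply: interp_subst_mono hw => y A d yJ.
have [j [ey ej _ _]] := arg_substP Pr (or_intror erefl) hr yJ.
have [j' [ey' ej' _ _]] := arg_substP Pl (or_introl erefl) hl yJ.
have [xty xinj _ _ _] := xJ (chain_heads ch hr).
have ltr : j < size (arg_types (sym_ty h)).
  have [_ side _ _ _] := Psdp Pr; have [_ _ ty] := side.
  by have [<- _] := has_type_base_args ty hr; apply: onth_size ej.
have ltl : j' < size (arg_types (sym_ty h)).
  have [side _ _ _ _] := Psdp Pl; have [_ _ ty] := side.
  by have [<- _] := has_type_base_args ty hl; apply: onth_size ej'.
(* Each side yields its own position for [y]; injectivity of [x h] identifies the two. *)
have ejj : j' = j by apply: xinj => //; rewrite -ey -ey'.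
subst j'; have [u] := args_steps _ _ ej'.
by rewrite ej => -[<-]; apply: interp_steps.
Qed.

End IntegerMapping.

Lemma integer_mapping_processor_sound (Z : int_theory R) rho :
  integer_mapping_processor Z rho -> sound R CC H (lift_processor rho).
Proof.
move=> gp; apply: lift_processor_sound => P Q Psdp rP fin [c [ch co]].
have [P' [x [J [_ xJ strict weak eQ]]]] := gp P Q Psdp rP.
have inf := removed_infinitely_often ch co (fin (P `\` P') ltac:(by rewrite eQ)).
pose Jl i := map_int x J (mark (sdp_l (c i).1)).
pose Jr i := map_int x J (mark (sdp_r (c i).1)).
pose ev i t z := @interp U R (subst (c i).2 t) (Base (int_sort Z)) (ofz Z z).
have side i : sdp_side R (sdp_l (c i).1) /\ sdp_side R (sdp_r (c i).1).
  by have [/Psdp[]] := ch.1 i isT.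
have ex i : exists z, ev i (Jl i) z.
  have [Pi ri] := ch.1 i isT; have [f [hf _]] := sdp_side_head (side i).1.
  by have [w hw] := map_int_evaluates Psdp xJ Pi ri (or_introl erefl) hf; exists w.
have [z hz] := choice ex.
(* The right-hand side at [i] and the left-hand side at [i.+1] have the same value, so the single
   sequence [z] describes both. *)
have hz' i : ev i (Jr i) (z i.+1).
  have [Pi ri] := ch.1 i isT; have [f [hf _]] := sdp_side_head (side i).2.
  have [w hw] := map_int_evaluates Psdp xJ Pi ri (or_intror erefl) hf.
  by rewrite -(chain_evaluates Psdp xJ ch hw (hz i.+1)).
have Ll i y : y \in FV (Jl i) -> sdp_L (c i).1 y.
  have [Pi ri] := ch.1 i isT; have [f [hf _]] := sdp_side_head (side i).1.
  exact: (FV_map_int Psdp xJ Pi (or_introl erefl) hf).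
have Lr i y : y \in FV (Jr i) -> sdp_L (c i).1 y.
  have [Pi ri] := ch.1 i isT; have [f [hf _]] := sdp_side_head (side i).2.
  exact: (FV_map_int Psdp xJ Pi (or_intror erefl) hf).
have dec i : P' (c i).1 -> (0 <= z i)%R /\ (z i.+1 < z i)%R.
  move=> P'i; have [Pi ri] := ch.1 i isT.
  have [|s' hs' mono] := respects_entails (Psdp _ Pi) ri (strict _ P'i).
    by move=> y /=; rewrite !mem_cat !in_nil /= orbF => /orP[/Ll|/orP[/Ll|/Lr]].
  have [h1 h2] := holds_and hs'.
  have zl := mono _ _ _ (Ll i) (hz i); have zr := mono _ _ _ (Lr i) (hz' i).
  by split; [apply: holds_ge zl (zero_symE Z) h1|apply: holds_gt zl zr h2].
apply: (@int_not_infinitely_decreasing z) => [i|n]; last first.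
  by have [m nm /dec] := inf n; exists m.
have [/dec[_ /Order.POrderTheory.ltW//]|nP'] := EM (P' (c i).1).
have [Pi ri] := ch.1 i isT.
have [|s' hs' mono] := respects_entails (Psdp _ Pi) ri (weak _ Pi nP').
  by move=> y /=; rewrite !mem_cat => /orP[/Ll|/Lr].
have zl := mono _ _ _ (Ll i) (hz i); have zr := mono _ _ _ (Lr i) (hz' i).
exact: holds_ge zl zr hs'.
Qed.

(** * Reachability and constraint modification *)

Lemma reachability_processor_sound rho :
  reachability_processor R H rho -> sound R CC H rho.
Proof.
move=> rp P f Q Psdp rP fin.
have [G [e [theta [-> ga eQ]]]] := rp P f Q Psdp rP.
move=> [c [ch co pub]]; subst Q; apply: (fin _ erefl); exists c; split=> //.
apply: (chain_in ch) => i; have [Pi _] := ch.1 i isT; have [P0 _] := ch.1 0 isT.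
split=> //; exists (c 0).1; split=> //.
exact: chain_connect ga ch _.
Qed.

(** Covering SDPs are chosen index by index. As the sides and their instances do not change, the
    steps, computability and publicness of the first SDP carry over. *)
Lemma constraint_modification_processor_sound rho :
  constraint_modification_processor R rho -> sound R CC H rho.
Proof.
move=> cp P f Q Psdp rP fin.
have [P' [P'sdp cov eQ]] := cp P f Q Psdp rP; subst Q.
have {}fin := fin _ erefl.
have translate c : chain R P None c -> computable_chain R CC None c ->
    exists c', [/\ chain R P' None c', computable_chain R CC None c'
      & sdp_l (c' 0).1 = sdp_l (c 0).1].
  move=> [cP cs] co.
  have ex i : exists d, [/\ P' d.1, sdp_l d.1 = sdp_l (c i).1 /\ sdp_r d.1 = sdp_r (c i).1,
      respects R d.1 d.2,
      subst (c i).2 (sdp_l (c i).1) = subst d.2 (sdp_l (c i).1)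
    & subst (c i).2 (sdp_r (c i).1) = subst d.2 (sdp_r (c i).1)].
    have [Pi ri] := cP i isT; have [p2 [s2 h]] := cov _ _ Pi ri.
    by exists (p2, s2).
  have [c' hc'] := choice ex; exists c'; split; last by have [_ []] := hc' 0.
    split=> i _; first by have [] := hc' i.
    have [_ [_ er] _ _ e1] := hc' i; have [_ [el _] _ e2 _] := hc' i.+1.
    have [/Psdp[_ [_ [f' hr _] _] _ _ _] _] := cP i isT.
    have [/Psdp[[_ [g' hl _] _] _ _ _ _] _] := cP i.+1 isT.
    (* Covering relates unmarked sides; marking commutes with substitution because the heads are
       symbols. *)
    rewrite er el (subst_mark _ hr) (subst_mark _ hl) -e1 -e2.
    by rewrite -(subst_mark _ hr) -(subst_mark _ hl); apply: cs.
  move=> i u _; have [_ [_ ->] _ _ e] := hc' i => ur.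
  (* The two substitutions agree on the variables of the right-hand side, thus on those of its
     subterm [u]. *)
  have <- : subst (c i).2 u = subst (c' i).2 u; last exact: co.
  by apply: eq_subst => y yu; apply: subst_eq_FV e (subterm_FV ur.1 yu).
case: f rP fin => rP fin [c].
  by case=> ch co; have [c' [h1 h2 _]] := translate c ch co; apply: fin; exists c'.
case=> ch co [g hg nH]; have [c' [h1 h2 h3]] := translate c ch co.
by apply: fin; exists c'; split=> //; exists g; rewrite ?h3.
Qed.

(** * Theory argument mappings *)

Section TheoryArguments.
Variables (P : set (sdp U)) (tau : sym U -> set nat).
Hypotheses (Psdp : P `<=` is_sdp R) (tauP : theory_argument_mapping R P tau).

(** The condition that [tau_bar] adds to [respects]. *)
Definition theory_instance (d : sdp U * substitution U) : Prop :=
  forall y, tau_vars tau d.1 y -> theory_term R (d.2 y) /\ ground (d.2 y).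

(** The selected arguments on the right are ground theory terms and remain so under rewriting; a
    variable of the matching argument on the left is then instantiated by a subterm of such a
    term. *)
Lemma theory_instance_next c i : chain R P None c ->
  (forall g j u y, head (mark (sdp_r (c i).1)) = Sym g -> tau g j ->
     onth (args (mark (sdp_r (c i).1))) j = Some u -> y \in FV u ->
     theory_term R ((c i).2 y) /\ ground ((c i).2 y)) ->
  theory_instance (c i.+1).
Proof.
move=> ch hyp y [g [j [u [hg tg ju yu]]]].
have [h [hr hl args_steps]] := chain_link i Psdp ch.
have egh : g = h by move: hl; rewrite hg => -[].
subst h; have [v jv st] := args_steps _ _ ju.
have [_ _ /(_ _ _ _ _ (ch.1 i isT).1 hr tg jv)[th _]] := tauP.
apply: ground_theory_subst_var yu _; apply: (steps_ground_theory R_lcstrs st).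
by apply: ground_theory_subst => // z; apply: hyp hr tg jv.
Qed.

Lemma theory_instance_fixed P' c i : chain R P None c -> fixes tau P' ->
  P' (c i).1 -> theory_instance (c i.+1).
Proof.
move=> ch fx P'i; apply: (theory_instance_next ch) => g j u y hg tg ju yu.
have [_ [_ th _]] := ch.1 i isT.
by apply: th; apply: fx hg tg ju yu.
Qed.

(** Induction along the chain: the variables of selected right-hand arguments lie in [sdp_L] or in
    [tau_vars], and the latter are handled by the previous index. *)
Lemma theory_instance_tail P' c i j : chain R P None c -> fixes tau P' ->
  P' (c i).1 -> i < j -> theory_instance (c j).
Proof.
move=> ch fx P'i; elim: j => [//|j IH]; rewrite ltnS leq_eqVlt => /orP[/eqP<-|/IH ti].
  exact: theory_instance_fixed ch fx P'i.
apply: (theory_instance_next ch) => g k u y hg tg ku yu.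
have [Pj [_ th _]] := ch.1 j isT.
have [_ _ /(_ _ _ _ _ Pj hg tg ku)[_ /(_ y yu)[Ly|ty]]] := tauP; first exact: th.
exact: ti.
Qed.

Lemma respects_tau_bar d : respects R d.1 d.2 -> theory_instance d ->
  respects R (tau_bar tau d.1) d.2.
Proof. by case=> sub th ho ti; split=> // y [/th|/ti]. Qed.

Lemma tau_bar_tail_chain P' c i : chain R P None c -> computable_chain R CC None c ->
  fixes tau P' -> P' (c i).1 -> ~ finite_problem R CC H (tau_bar tau @` P, an).
Proof.
move=> ch co fx P'i; apply.
have [tP ts] := chain_tail i.+1 ch.
exists (fun k => (tau_bar tau (c (i.+1 + k)).1, (c (i.+1 + k)).2)); split.
  split=> k _; last exact: ts.
  have [Pk rk] := tP k isT; split; first by exists (c (i.+1 + k)).1.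
  by apply: respects_tau_bar rk _; apply: theory_instance_tail ch fx P'i _; lia.
by move=> k u _; apply: co.
Qed.

End TheoryArguments.

Lemma theory_argument_processor_sound rho :
  theory_argument_processor R H rho -> sound R CC H rho.
Proof.
move=> tp P f Q Psdp rP fin.
have [tau [P' [tauP [P'P _] fx]]] := tp P f Q Psdp rP.
have never c : chain R P None c -> computable_chain R CC None c ->
    finite_problem R CC H (tau_bar tau @` P, an) -> chain R (P `\` P') None c.
  move=> ch co fin1; apply: (chain_in ch) => i; split; first by apply (ch.1 i isT).
  by move=> P'i; apply: (tau_bar_tail_chain Psdp tauP ch co fx P'i).
case: f rP => rP.
  move=> eQ; subst Q; case=> c [ch co].
  apply: (fin (P `\` P', an)); first by right.
  exists c; split=> //; apply: never => //.
  by apply: fin; left.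
case=> Qsub Qnsub [c [ch co pub]].
have [sub|nsub] := EM (P `&` public H `<=` P'); last first.
  have eQ := Qnsub nsub; subst Q.
  apply: (fin (P `\` P', pu)); first by right.
  exists c; split=> //; apply: never => //.
  by apply: fin; left.
have eQ := Qsub sub; subst Q; apply: (fin _ erefl).
(* The chain starts in [P'], so every later SDP can be relabelled; nothing is cut off, which keeps
   the first SDP public. *)
have P'0 : P' (c 0).1 by apply: sub; split=> //; apply (ch.1 0 isT).
pose p' i := if pselect (public H (c i).1) then (c i).1 else tau_bar tau (c i).1.
have p'l i : sdp_l (p' i) = sdp_l (c i).1 by rewrite /p'; case: pselect.
have p'r i : sdp_r (p' i) = sdp_r (c i).1 by rewrite /p'; case: pselect.
exists (fun i => (p' i, (c i).2)); split.
- split=> i _ /=; last by rewrite p'l p'r; apply: ch.2.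
  have [Pi ri] := ch.1 i isT.
  rewrite /p'; case: pselect => pi; first by split=> //; left.
  split; first by right; exists (c i).1.
  (* Index 0 is excluded here, since the first SDP is public. *)
  apply: respects_tau_bar ri _; case: i pi {Pi} => [//|i] _.
  exact: (theory_instance_tail Psdp tauP ch fx P'0).
- by move=> i u _ /=; rewrite p'r; apply: co.
- by case: pub => g hg nH; exists g; rewrite //= p'l.
Qed.

End Processors.

Theorem theorem38 (U : universe) (R0 R1 R : lcstrs U) (H : set (sym U))
    (ge : tsort U -> tsort U -> Prop) (CC : tsort U -> set (term U))
    (R0_lcstrs : is_lcstrs R0)
    (H_hidden : H `<=` syms R0)
    (R1_lcstrs : is_lcstrs R1)
    (R1_extension : extension R0 R1)
    (R1_public : public_system H R1)
    (R_union : R = lcstrs_union R0 R1)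
    (R_lcstrs : is_lcstrs R)
    (R_fresh : fresh_marks R)
    (ge_ordering : sort_ordering ge R)
    (CC_computability : computability_set ge R CC) :
  [/\ forall rho : base_processor,
        graph_processor R rho \/ subterm_criterion_processor R rho \/
        (exists Z : int_theory R, integer_mapping_processor Z rho) ->
        sound R CC H (lift_processor rho),
      forall rho : processor,
        theory_argument_processor R H rho -> sound R CC H rho,
      forall rho : processor,
        constraint_modification_processor R rho -> sound R CC H rho
    & forall rho : processor,
        reachability_processor R H rho -> sound R CC H rho].
Proof.
have [CC_rc _] := CC_computability; split.
- move=> rho [gp|[sp|[Z zp]]].
  + exact: graph_processor_sound gp.
  + exact: (subterm_criterion_processor_sound (H:=H) R_lcstrs R_fresh CC_rc sp).
  + exact: (integer_mapping_processor_sound (H:=H) R_lcstrs R_fresh zp).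
- by move=> rho; apply: theory_argument_processor_sound.
- by move=> rho; apply: constraint_modification_processor_sound.
- by move=> rho; apply: reachability_processor_sound.
Qed.
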